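(* There is an $\mathcal{O}(n)$-time algorithm solving Temporal Resolving Set on temporal paths on $n$ vertices with a 1-labeling.
   Context: A temporal graph $\mathcal{G}=(V,E,\lambda)$ consists of a finite simple undirected graph $(V,E)$ (the underlying graph) and a time labeling $\lambda$ assigning to each edge $e\in E$ a nonempty finite set $\lambda(e)$ of positive integers (the time-steps at which $e$ is present). $\lambda$ is a 1-labeling if $|\lambda(e)|\le 1$ (hence $=1$) for every edge. A temporal path is a temporal graph whose underlying graph is a path. A journey from $u$ to $v$ is a path in the underlying graph from $u$ to $v$ together with a choice, for each edge of the path, of a time-step in its label set so that the chosen time-steps are strictly increasing along the path. The temporal distance $\mathrm{dist}_t(u,v)$ is the smallest time-step at which a journey from $u$ reaches $v$ (with $\mathrm{dist}_t(u,u)=0$, and $\mathrm{dist}_t(u,v)=\infty$ if there is no journey from $u$ to $v$). A vertex $v$ is reachable from $u$ if there is a journey from $u$ to $v$ (every vertex is reachable from itself). A set $R\subseteq V$ is a temporal resolving set if (i) every $v\in V$ is reachable from some $s\in R$, and (ii) for every two distinct $u,v\in V$ there is $s\in R$ with $\mathrm{dist}_t(s,u)\neq \mathrm{dist}_t(s,v)$. Temporal Resolving Set is the problem: given a temporal graph $\mathcal{G}=(V,E,\lambda)$ and an integer $k$, decide whether there is a temporal resolving set of $\mathcal{G}$ of size at most $k$. Running time counts elementary operations, with a comparison of two time labels taking constant time. *)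

(* Defs.v *)
From mathcomp Require Import all_boot finmap boolp.

Set Implicit Arguments.
Unset Strict Implicit.
Unset Printing Implicit Defensive.

(** * Temporal graphs (MathComp) *)

(* Only the values of [labels] on members of [edges] are meaningful. *)
Record tgraph (V : finType) := TGraph {
  edges : {set {set V}};
  labels : {set V} -> {fset nat};
  edges_card2 : forall e, e \in edges -> #|e| = 2;
  labels_neq0 : forall e, e \in edges -> labels e != fset0;
  labels_pos : forall e t, e \in edges -> t \in labels e -> 0 < t }.

Section TemporalGraphs.
Variable V : finType.
Implicit Types (G : tgraph V) (u v : V).

Definition one_labeling G : Prop :=
  forall e, e \in edges G -> #|` labels G e| <= 1.

(* [x :: p] lists the vertices along the path; [pairmap] produces the
   pairs of consecutive vertices. *)
Definition temporal_path G : Prop :=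
  exists (x : V) (p : seq V),
    [/\ uniq (x :: p),
        forall v, v \in x :: p
      & edges G = [set e in pairmap (fun u v => [set u; v]) x p]].

(* A journey is the list of its steps, a step being the vertex it enters and
   the time-step at which it does so.  The start is given the fictitious time
   0: this does not constrain the first step, since labels are positive, and
   it makes 0 the arrival time of the empty journey. *)
Definition journey_step G (a b : V * nat) : bool :=
  [&& [set a.1; b.1] \in edges G,
      b.2 \in labels G [set a.1; b.1] & a.2 < b.2].

Definition journey G u v (s : seq (V * nat)) : bool :=
  [&& path (journey_step G) (u, 0) s,
      uniq (u :: unzip1 s) & last u (unzip1 s) == v].

Definition reachable G u v : Prop := exists s, journey G u v s.

Definition arrives G u v (t : nat) : Prop :=
  exists2 s, journey G u v s & last 0 (unzip2 s) = t.

(* [None] stands for an infinite distance. *)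
Definition tdist G u v : option nat :=
  if pselect (exists t, `[< arrives G u v t >]) is left h
  then Some (ex_minn h) else None.

Definition temporal_resolving_set G (R : {set V}) : Prop :=
  (forall v, exists2 s, s \in R & reachable G s v) /\
  (forall u v, u != v -> exists2 s, s \in R & tdist G s u <> tdist G s v).

Definition has_temporal_resolving_set G (k : nat) : Prop :=
  exists2 R : {set V}, temporal_resolving_set G R & #|R| <= k.

End TemporalGraphs.

(** * A machine model with unit-cost elementary operations

    Programs of a while-language over natural-number variables and arrays (an
    array cell is accessed in constant time through its index).  Arithmetic is
    restricted to successor and predecessor, so that after [T] operations no
    value exceeds the input values and program constants by more than [T].
    Time labels are not machine values: they form a read-only sequence whose
    only operation is the comparison of the labels at two given positions. *)

Inductive expr : Type :=
  | Const of nat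
  | Var of nat
  | Get of nat & expr
  | Succ of expr
  | Pred of expr.

Inductive test : Type :=
  | Lt of expr & expr
  | LabelLt of expr & expr
  | Not of test
  | And of test & test.

Inductive cmd : Type :=
  | Skip
  | Assign of nat & expr
  | Put of nat & expr & expr
  | Seq of cmd & cmd
  | If of test & cmd & cmd
  | While of test & cmd.

Record state := State { vars : nat -> nat; arrs : nat -> nat -> nat }.

Definition upd (T : Type) (f : nat -> T) (i : nat) (x : T) : nat -> T :=
  fun j => if j == i then x else f j.

Definition set_var (st : state) (x val : nat) : state :=
  State (upd (vars st) x val) (arrs st).

Definition set_cell (st : state) (a i val : nat) : state :=
  State (vars st) (upd (arrs st) a (upd (arrs st a) i val)).

Fixpoint eval (st : state) (e : expr) : nat :=
  match e with
  | Const m => m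
  | Var x => vars st x
  | Get a i => arrs st a (eval st i)
  | Succ e1 => (eval st e1).+1
  | Pred e1 => (eval st e1).-1
  end.

Fixpoint expr_cost (e : expr) : nat :=
  match e with
  | Const _ | Var _ => 1
  | Get _ e1 | Succ e1 | Pred e1 => (expr_cost e1).+1
  end.

Fixpoint holds (lab : seq nat) (st : state) (b : test) : bool :=
  match b with
  | Lt e1 e2 => eval st e1 < eval st e2
  | LabelLt e1 e2 => nth 0 lab (eval st e1) < nth 0 lab (eval st e2)
  | Not b1 => ~~ holds lab st b1
  | And b1 b2 => holds lab st b1 && holds lab st b2
  end.

Fixpoint test_cost (b : test) : nat :=
  match b with
  | Lt e1 e2 | LabelLt e1 e2 => (expr_cost e1 + expr_cost e2).+1
  | Not b1 => (test_cost b1).+1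
  | And b1 b2 => (test_cost b1 + test_cost b2).+1
  end.

(* [exec lab c st T st']: started in [st], the program [c] terminates in [st']
   after exactly [T] elementary operations. *)
Inductive exec (lab : seq nat) : cmd -> state -> nat -> state -> Prop :=
  | ExecSkip st : exec lab Skip st 1 st
  | ExecAssign st x e :
      exec lab (Assign x e) st (expr_cost e).+1 (set_var st x (eval st e))
  | ExecPut st a i e :
      exec lab (Put a i e) st (expr_cost i + expr_cost e).+1
        (set_cell st a (eval st i) (eval st e))
  | ExecSeq st1 st2 st3 c1 c2 T1 T2 :
      exec lab c1 st1 T1 st2 -> exec lab c2 st2 T2 st3 ->
      exec lab (Seq c1 c2) st1 (T1 + T2) st3
  | ExecIfTrue st st' b c1 c2 T :
      holds lab st b -> exec lab c1 st T st' ->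
      exec lab (If b c1 c2) st (test_cost b + T).+1 st'
  | ExecIfFalse st st' b c1 c2 T :
      ~~ holds lab st b -> exec lab c2 st T st' ->
      exec lab (If b c1 c2) st (test_cost b + T).+1 st'
  | ExecWhileTrue st1 st2 st3 b c T1 T2 :
      holds lab st1 b -> exec lab c st1 T1 st2 ->
      exec lab (While b c) st2 T2 st3 ->
      exec lab (While b c) st1 (test_cost b + T1 + T2).+1 st3
  | ExecWhileFalse st b c :
      ~~ holds lab st b -> exec lab (While b c) st (test_cost b).+1 st.

(** * Encoding of instances

    A temporal graph on the vertices 0, ..., n-1 is presented by the list of its
    time-edges [(u, v, t)], in any order and with each edge oriented
    arbitrarily, every pair of an edge and one of its labels occurring once. *)

Definition time_edge (n : nat) (x : 'I_n * 'I_n * nat) : {set 'I_n} * nat :=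
  ([set x.1.1; x.1.2], x.2).

Definition encodes (n : nat) (w : seq ('I_n * 'I_n * nat)) (G : tgraph 'I_n) :
    Prop :=
  uniq (map (@time_edge n) w) /\
  forall e t,
    ((e, t) \in map (@time_edge n) w) = (e \in edges G) && (t \in labels G e).

(* Variables 0, 1, 2 hold the number of vertices, the bound [k] and the number
   of time-edges; arrays 0 and 1 hold the two endpoints of the time-edges.  All
   other variables and cells are 0. *)
Definition init_state (n k : nat) (w : seq ('I_n * 'I_n * nat)) : state :=
  State (nth 0 [:: n; k; size w])
        (nth (fun=> 0)
           [:: nth 0 [seq nat_of_ord x.1.1 | x <- w];
               nth 0 [seq nat_of_ord x.1.2 | x <- w]]).

(* The answer is "yes" when variable 0 is nonzero at termination. *)
Definition decides_within (c : cmd) (n k : nat) (w : seq ('I_n * 'I_n * nat))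
    (bound : nat) (answer : Prop) : Prop :=
  exists T st,
    [/\ exec (unzip2 w) c (init_state k w) T st,
        T <= bound
      & vars st 0 != 0 <-> answer].

(* Main.v *)
Require Import Defs.
From mathcomp Require Import all_boot finmap boolp zify.

(** Let [T i] be the label of the edge between the positions [i-1] and [i].
    A source at [s] reaches a position on its right (left) exactly when the
    labels increase away from [s], so two vertices [j < l] reached from [s] are
    confused only if [s] lies between them, the labels decrease from [j] to [s]
    and increase from [s] to [l], and [T (j+1) = T l]: a "collision".  When all
    vertices are reached, [j] and [l] are separated as soon as some source
    reaching [j] or [l] is not one of the at most two bottoms ("centres") of
    that valley; hence within a valley only the innermost collision matters.
    Each condition asks for a source in an interval, possibly with the centres
    removed, and all of them can be checked by one finite automaton that reads
    the membership of the vertices in the set from left to right.  The minimum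
    size of an accepted set is computed by dynamic programming over the states.
    The innermost collisions are found by moving two pointers away from the
    bottom of each valley; every left move is paid for by one falling vertex
    scanned before, so the total time is linear. *)

Set Implicit Arguments.
Unset Strict Implicit.
Unset Printing Implicit Defensive.

(** * Execution of programs *)

(** The obstacle to reading the conditions from left to right is that the condition of a collision
    refers to both of its ends, and that collisions nest arbitrarily deep. Two facts make it local.
    Inside a collision, being a centre depends only on the types of a vertex and its neighbours, so
    it becomes a bit of the letter instead of a relation to [(j, l)]. And innermost collisions, cut
    off at [l.-1], meet in at most one vertex, so one bit tells whether the collision opened last is
    already separated; a source to the right of a vertex is treated as a debt that falling vertices
    hand on. The automaton has 16 states and 32 letters, so its transitions are compiled into
    straight-line code and a step of the dynamic program has constant cost. Labels can only be
    compared, so the program stores positions of labels in the input; a position past the end reads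
    as 0 and serves as the sentinel. The order of the path is unknown at the outset and is recovered
    only up to reversal, which is harmless because every statement about the line holds for both
    orientations. *)

Fixpoint loop_free (c : cmd) : bool :=
  match c with
  | Skip | Assign _ _ | Put _ _ _ => true
  | Seq c1 c2 | If _ c1 c2 => loop_free c1 && loop_free c2
  | While _ _ => false
  end.

(* Only meaningful for loop-free programs: loops count for 0. *)
Fixpoint max_cost (c : cmd) : nat :=
  match c with
  | Skip => 1
  | Assign _ e => (expr_cost e).+1
  | Put _ i e => (expr_cost i + expr_cost e).+1
  | Seq c1 c2 => max_cost c1 + max_cost c2
  | If b c1 c2 => (test_cost b + maxn (max_cost c1) (max_cost c2)).+1
  | While b c => 0
  end.

(* Only meaningful for loop-free programs: loops are skipped. *)
Fixpoint run (lab : seq nat) (c : cmd) (st : state) : state :=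
  match c with
  | Skip | While _ _ => st
  | Assign x e => set_var st x (eval st e)
  | Put a i e => set_cell st a (eval st i) (eval st e)
  | Seq c1 c2 => run lab c2 (run lab c1 st)
  | If b c1 c2 => if holds lab st b then run lab c1 st else run lab c2 st
  end.

Lemma exec_run lab c st : loop_free c ->
  exists2 T, exec lab c st T (run lab c st) & T <= max_cost c.
Proof.
elim: c st => //=.
- by move=> st _; exists 1 => //; constructor.
- by move=> x e st _; eexists; first by constructor.
- by move=> x e1 e st _; eexists; first by constructor.
- move=> c1 IH1 c2 IH2 st /andP[l1 l2].
  have [T1 E1 B1] := IH1 st l1.
  have [T2 E2 B2] := IH2 (run lab c1 st) l2.
  by exists (T1 + T2); [exact: ExecSeq E1 E2|exact: leq_add].
- move=> b c1 IH1 c2 IH2 st /andP[l1 l2].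
  case: (boolP (holds lab st b)) => hb.
    have [T1 E1 B1] := IH1 st l1.
    by eexists; [apply: ExecIfTrue hb E1|lia].
  have [T1 E1 B1] := IH2 st l2.
  by eexists; [apply: ExecIfFalse hb E1|lia].
Qed.

Definition runs_to (lab : seq nat) (c : cmd) (st : state) (bound : nat)
    (Q : state -> Prop) : Prop :=
  exists T st', [/\ exec lab c st T st', T <= bound & Q st'].

Lemma runs_to_run lab c st (Q : state -> Prop) :
  loop_free c -> Q (run lab c st) -> runs_to lab c st (max_cost c) Q.
Proof.
by move=> lf q; have [T E B] := exec_run lab st lf; exists T, (run lab c st).
Qed.

Lemma runs_to_seq lab c1 c2 st b1 b2 (Q1 Q2 : state -> Prop) :
  runs_to lab c1 st b1 Q1 ->
  (forall st', Q1 st' -> runs_to lab c2 st' b2 Q2) ->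
  runs_to lab (Seq c1 c2) st (b1 + b2) Q2.
Proof.
move=> [T1 [st1 [E1 B1 q1]]] H; have [T2 [st2 [E2 B2 q2]]] := H _ q1.
exists (T1 + T2), st2; split=> //; [exact: ExecSeq E1 E2|exact: leq_add].
Qed.

Lemma runs_to_le lab c st b1 b2 (Q : state -> Prop) :
  b1 <= b2 -> runs_to lab c st b1 Q -> runs_to lab c st b2 Q.
Proof. by move=> le [T [st' [E B q]]]; exists T, st'; split=> //; lia. Qed.

(** In [fuel.+1] the last unit pays for the test that ends the loop. *)
Definition loop_cost (b : test) (c : cmd) (fuel : nat) : nat :=
  (test_cost b + max_cost c).+1 * fuel.+1.

(** Every loop of the algorithm has a loop-free body, hence a constant cost per round, so a strictly
    decreasing potential bounds the total cost. Amortised bounds enter only through the choice of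
    the potential. *)
Lemma runs_to_while lab b c (I : state -> Prop) (potential : state -> nat) st :
  loop_free c -> I st ->
  (forall st, I st -> holds lab st b ->
     I (run lab c st) /\ potential (run lab c st) < potential st) ->
  runs_to lab (While b c) st (loop_cost b c (potential st))
    (fun st' => I st' /\ ~~ holds lab st' b).
Proof.
move=> lf Ist step.
have [k] := ubnP (potential st); elim: k => // k IH in st Ist *.
rewrite ltnS => pk.
case: (boolP (holds lab st b)) => hb; last first.
  exists (test_cost b).+1, st; split=> //; first by constructor.
  by rewrite /loop_cost; nia.
have [I' p'] := step st Ist hb.
have [T [st' [E B Q]]] := IH _ I' ltac:(lia).
have [T1 E1 B1] := exec_run lab st lf.
exists (test_cost b + T1 + T).+1, st'; split=> //.
  exact: ExecWhileTrue hb E1 E.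
move: B; rewrite /loop_cost => B.
have : (test_cost b + max_cost c).+1 * (potential (run lab c st)).+1 <=
  (test_cost b + max_cost c).+1 * potential st by rewrite leq_mul2l; lia.
rewrite [_ * (potential st).+1]mulnS; lia.
Qed.

Definition seqs (cs : seq cmd) : cmd := foldr Seq Skip cs.

Lemma loop_free_seqs cs : loop_free (seqs cs) = all loop_free cs.
Proof. by elim: cs => //= c cs ->. Qed.

Definition eqe (e1 e2 : expr) : test := And (Not (Lt e1 e2)) (Not (Lt e2 e1)).

Lemma holds_eqe lab st e1 e2 :
  holds lab st (eqe e1 e2) = (eval st e1 == eval st e2).
Proof. rewrite /=; lia. Qed.

(** * Temporal distances on a labelled line *)

Section LabelledLine.
Variables (n : nat) (T : nat -> nat).

(* [T i] labels the edge between [i.-1] and [i]; [T 0 = T n = 0] are sentinels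
   that make the ends of the line ordinary vertices.  The test [0 < v] keeps
   the vertex 0 from counting as rising. *)
Definition rising (v : nat) : bool := (0 < v) && (T v < T v.+1).
Definition falling (v : nat) : bool := T v.+1 < T v.
Definition level (v : nat) : bool := (0 < v) && (T v == T v.+1).

Definition up (s v : nat) : bool := all rising (iota s.+1 (v - s.+1)).
Definition down (v s : nat) : bool := all falling (iota v.+1 (s - v.+1)).

Lemma upP s v : reflect (forall i, s < i -> i < v -> rising i) (up s v).
Proof.
apply: (iffP allP) => H i.
  by move=> si iv; apply: H; rewrite mem_iota; lia.
by rewrite mem_iota => /andP[si iv]; apply: H; lia.
Qed.

Lemma downP v s : reflect (forall i, v < i -> i < s -> falling i) (down v s).
Proof.
apply: (iffP allP) => H i.
  by move=> si iv; apply: H; rewrite mem_iota; lia.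
by rewrite mem_iota => /andP[si iv]; apply: H; lia.
Qed.

Lemma falling0F : T 0 = 0 -> falling 0 = false.
Proof. by rewrite /falling => ->. Qed.

Lemma levelF v : level v -> (rising v = false) * (falling v = false).
Proof. by rewrite /level /rising /falling => /andP[-> /eqP->]; rewrite ltnn. Qed.

Lemma rising_fallingF v : rising v -> falling v = false.
Proof. rewrite /rising /falling; lia. Qed.

Lemma vertexP v : 0 < v -> [|| rising v, falling v | level v].
Proof. rewrite /rising /falling /level; lia. Qed.

Lemma up_mono s v x y : up s v -> s < x -> x < y -> y <= v -> T x < T y.
Proof.
move=> /upP H sx; elim: y => // y IH xy yv.
have ly : T y < T y.+1 by case/andP: (H y ltac:(lia) ltac:(lia)).
have [->//|xy'] := eqVneq x y.
apply: ltn_trans (IH _ _) ly; lia.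
Qed.

Lemma down_mono v s x y : down v s -> v < x -> x < y -> y <= s -> T y < T x.
Proof.
move=> /downP H sx; elim: y => // y IH xy yv.
have ly : T y.+1 < T y by apply: (H y); lia.
have [->//|xy'] := eqVneq x y.
apply: ltn_trans ly (IH _ _); lia.
Qed.

Lemma up_sub s v s' v' : up s v -> s <= s' -> v' <= v -> up s' v'.
Proof. by move=> /upP H ? ?; apply/upP => i ? ?; apply: H; lia. Qed.

Lemma down_sub v s v' s' : down v s -> v <= v' -> s' <= s -> down v' s'.
Proof. by move=> /downP H ? ?; apply/downP => i ? ?; apply: H; lia. Qed.

Definition dist (s v : nat) : option nat :=
  if s == v then Some 0
  else if s < v then (if up s v then Some (T v) else None)
  else (if down v s then Some (T v.+1) else None).

Lemma dist_self s : dist s s = Some 0.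
Proof. by rewrite /dist eqxx. Qed.

Lemma dist_up s v : s < v -> dist s v = if up s v then Some (T v) else None.
Proof. by rewrite /dist => h; rewrite h; case: eqP => [e|//]; lia. Qed.

Lemma dist_down s v :
  v < s -> dist s v = if down v s then Some (T v.+1) else None.
Proof.
move=> h; rewrite /dist; case: eqP => [e|_]; first by lia.
by case: ifP => // h'; lia.
Qed.

Definition reaches (s v : nat) : bool :=
  ((s <= v) && up s v) || ((v <= s) && down v s).

Lemma reachesE s v : reaches s v = (dist s v != None).
Proof.
rewrite /reaches; case: (ltngtP s v) => [h|h|->].
- by rewrite dist_up // orbF; case: up.
- by rewrite dist_down //=; case: down.
- rewrite dist_self; apply/orP; left; apply/upP; lia.
Qed.

Definition covered (b : nat -> bool) (v : nat) : Prop :=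
  exists s, [/\ s < n, b s & reaches s v].

Definition resolves (b : nat -> bool) : Prop :=
  (forall v, v < n -> covered b v) /\
  (forall u v, u < n -> v < n -> u != v ->
     exists s, [/\ s < n, b s & dist s u <> dist s v]).

(** [down] and [up] constrain only the vertices strictly between, so nothing is asked of [s] itself.
    For a collision this gives one centre if it is level, and otherwise the two ends of the lowest
    edge. *)
Definition centre (j l s : nat) : bool := [&& j < s, s < l, down j s & up s l].

Definition collision (j l : nat) : Prop :=
  [/\ j.+1 < l, l < n, T j.+1 = T l & exists s, centre j l s].

(* Inside a collision, these are exactly the centres: see [frozen_centre]. *)
Definition frozen (v : nat) : bool :=
  [|| level v, falling v && rising v.+1 | rising v && falling v.-1].

Lemma centre_edges j l s : centre j l s ->
  (forall i, j < i < s -> falling i) /\ (forall i, s < i < l -> rising i).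
Proof.
move=> /and4P[js sl /downP D /upP U].
by split=> i /andP[? ?]; [apply: D|apply: U].
Qed.

(** If [s.+1] were [l], the fall at [s] would put [T l] below [T s], which is at most [T j.+1]
    because the labels decrease from [j] to [s]. *)
Lemma centre_falling j l s : T j.+1 = T l -> centre j l s -> falling s ->
  s.+1 < l /\ rising s.+1.
Proof.
move=> e /and4P[js sl D /upP U] g.
have sl' : s.+1 < l.
  rewrite ltn_neqAle sl andbT; apply/eqP => E; subst l.
  move: g; rewrite /falling -e; case: (eqVneq j.+1 s) => [->|ne]; first by lia.
  have : T s < T j.+1 by apply: (down_mono D); lia.
  lia.
by split=> //; apply: U; lia.
Qed.

Lemma centre_rising j l s : T j.+1 = T l -> centre j l s -> rising s ->
  j.+1 < s /\ falling s.-1.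
Proof.
move=> e /and4P[js sl /downP D U] g.
have sl' : j.+1 < s.
  rewrite ltn_neqAle js andbT; apply/eqP => E; subst s.
  move: g; rewrite /rising e; case: (eqVneq j.+2 l) => [->|ne]; first by lia.
  have : T j.+2 < T l by apply: (up_mono U); lia.
  lia.
by split=> //; apply: D; lia.
Qed.

Lemma centre_shiftr j l s : T j.+1 = T l -> centre j l s -> falling s ->
  centre j l s.+1.
Proof.
move=> e c g; have [h _] := centre_falling e c g.
move: c => /and4P[js sl /downP D U]; apply/and4P; split=> //; first by lia.
  apply/downP => i ji; rewrite ltnS leq_eqVlt => /orP[/eqP->//|]; exact: D.
exact: up_sub U _ _.
Qed.

Lemma centre_shiftl j l s : T j.+1 = T l -> centre j l s -> rising s ->
  centre j l s.-1.
Proof.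
move=> e c g; have [h _] := centre_rising e c g.
move: c => /and4P[js sl D /upP U]; apply/and4P; split=> //; try by lia.
  by apply: down_sub D _ _; lia.
apply/upP => i ji il; have [->//|ne] := eqVneq i s; apply: U; lia.
Qed.

(** Vertices before a centre fall and vertices after it rise, so the patterns of [frozen] can occur
    only where the two sides meet. The gain is that the left-hand side does not mention [j] and
    [l]. *)
Lemma frozen_centre j l v : collision j l -> j < v < l ->
  frozen v = centre j l v.
Proof.
case=> jl ln e [s c] jvl; apply/idP/idP => [|cv]; last first.
  have := vertexP (v := v) ltac:(lia); rewrite /frozen => /or3P[g|g|->//].
    by have [_ ->] := centre_rising e cv g; rewrite g !orbT.
  by have [_ ->] := centre_falling e cv g; rewrite g !orbT.
have [D U] := centre_edges c; have cc := c.
move: cc => /and4P[js sl _ _].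
have [->//|ne] := eqVneq v s.
have [vs|sv] : v < s \/ s < v by lia.
  have gv : falling v by apply: D; lia.
  case/or3P => [/levelF[_]|/andP[_ lv]|/andP[/rising_fallingF]].
  - by rewrite gv.
  - have E : s = v.+1.
      apply/eqP; apply: contraTT isT => ne'.
      by have := D v.+1 ltac:(lia); rewrite rising_fallingF.
    by have := centre_shiftl e c; rewrite E; apply.
  - by rewrite gv.
have gv : rising v by apply: U; lia.
case/or3P => [/levelF[]|/andP[]|/andP[_ lv]].
- by rewrite gv.
- by rewrite rising_fallingF.
- have E : s = v.-1.
    apply/eqP; apply: contraTT isT => ne'.
    by have := U v.-1 ltac:(lia); move/rising_fallingF; rewrite lv.
  have := centre_shiftr e c; rewrite E prednK; last by lia.
  exact.
Qed.

(** An outer source has to reach only the nearer end: the farther one is then reached strictly later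
    or not at all. *)
Definition separated (b : nat -> bool) (j l : nat) : Prop :=
  exists s, [/\ s < n, b s &
    [|| (s <= j) && up s j, [&& j < s, s < l & ~~ frozen s]
      | (l <= s) && down l s]].

Definition innermost (j l : nat) : Prop :=
  collision j l /\
  forall j' l', j <= j' -> l' <= l -> collision j' l' -> j' = j /\ l' = l.

Lemma innermost_ex j l : collision j l ->
  exists j' l', [/\ innermost j' l', j <= j' & l' <= l].
Proof.
have [k] := ubnP (l - j); elim: k j l => // k IH j l lk c.
have [h|h] := pselect (exists j' l',
    [/\ j <= j', l' <= l, collision j' l' & (j', l') <> (j, l)]).
  have [j' [l' [jj ll c' ne]]] := h.
  case: (IH j' l' _ c') => [|j2 [l2 [I ? ?]]].
    case: (c') => h1 _ _ _; have [E|] := eqVneq j' j; last by lia.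
    have [E'|] := eqVneq l' l; last by lia.
    by rewrite E E' in ne.
  by exists j2, l2; split => //; lia.
exists j, l; split => //; split=> // j' l' jj ll c'.
by apply: contrapT => ne; apply: h; exists j', l'; split=> // -[E1 E2]; apply: ne.
Qed.

(** A source between the two pairs is no centre of the outer one: monotone labels from it through
    the whole inner pair would make [T j'.+1] and [T l'] different. *)
Lemma separated_nested b j l j' l' : collision j l -> collision j' l' ->
  j <= j' -> l' <= l -> separated b j' l' -> separated b j l.
Proof.
move=> c c' jj ll [s [sn bs H]]; exists s; split=> //.
have [jl' ln' e' _] := c'.
have [jl ln e _] := c.
case/or3P: H => [/andP[sj U]|/and3P[js sl fr]|/andP[sl D]].
- have [sj'|js] := leqP s j; first by rewrite (up_sub U).
  apply/or3P/Or32; apply/and3P; split=> //; first by lia.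
  apply/negP; rewrite (frozen_centre c); last by lia.
  move=> /and4P[_ _ _ U']; suff : T j'.+1 < T l' by lia.
  by apply: (up_mono U'); lia.
- apply/or3P/Or32; apply/and3P; split=> //; lia.
- have [sj'|js] := leqP l s; first by rewrite (down_sub D) ?orbT.
  apply/or3P/Or32; apply/and3P; split=> //; first by lia.
  apply/negP; rewrite (frozen_centre c); last by lia.
  move=> /and4P[_ _ U' _]; suff : T l' < T j'.+1 by lia.
  by apply: (down_mono U'); lia.
Qed.

(** An outer source that misses the nearer end misses both ends, and a centre reaches both at the
    same time, so neither tells [j] and [l] apart. *)
Lemma resolves_collision b j l : resolves b -> collision j l -> separated b j l.
Proof.
move=> [_ R] c; have [jl ln e [c0 cc]] := c.
have [s [sn bs ne]] := R j l ltac:(lia) ln ltac:(lia).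
exists s; split=> //.
have [sj|js] := leqP s j.
  apply/or3P/Or31; rewrite /=; move: sj; rewrite leq_eqVlt => /orP[/eqP->|sj].
    by apply/upP; lia.
  apply: contra_notT ne => nu.
  rewrite !dist_up ?(negPf nu); [|lia|lia].
  by case: ifP => // h; rewrite (up_sub h) in nu; lia.
have [sl|ls] := leqP l s.
  apply/or3P/Or33; rewrite /=; move: sl; rewrite leq_eqVlt => /orP[/eqP->|sj].
    by apply/downP; lia.
  apply: contra_notT ne => nu.
  rewrite !dist_down ?(negPf nu); [|lia|lia].
  by case: ifP => // h; rewrite (down_sub h) in nu; lia.
apply/or3P/Or32; rewrite andTb; apply/negP; rewrite (frozen_centre c); last by lia.
move=> /and4P[_ _ D U]; apply: ne.
by rewrite (dist_up ls) (dist_down js) D U e.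
Qed.

(** A larger overlap forces [j' < s] and [s' < l] for the two centres, and [l < l'] by minimality.
    Then [T l < T l' = T j'.+1 < T j.+1 = T l]. This is what allows a single bit for the current
    collision. *)
Lemma innermost_disjoint j l j' l' :
  innermost j l -> innermost j' l' -> j < j' -> l <= j'.+1.
Proof.
move=> [[jl ln e [s c]] I] [c' I'] jj; rewrite leqNgt; apply/negP => lj.
have [jl' ln' e' [s' cs']] := c'.
have ll' : l < l'.
  rewrite ltnNge; apply/negP => h.
  have [E _] := I j' l' ltac:(lia) h c'; lia.
have [D U] := centre_edges c.
have [D' U'] := centre_edges cs'.
have /and4P[js sl Ds Us] := c; have /and4P[js' sl' Ds' Us'] := cs'.
have j's : j' < s.
  rewrite ltnNge; apply/negP => sj.
  have lj1 : rising j'.+1 by apply: U; lia.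
  have [E|ne] := eqVneq s' j'.+1.
    have [h _] := centre_rising e' cs' ltac:(by rewrite E); lia.
  have := D' j'.+1 ltac:(lia); rewrite rising_fallingF //.
have s'l : s' < l.
  rewrite ltnNge; apply/negP => ls.
  have g : falling l.-1 by apply: D'; lia.
  have [E|ne] := eqVneq s l.-1.
    have [h _] := centre_falling e c ltac:(by rewrite E); lia.
  have := U l.-1 ltac:(lia); move/rising_fallingF; rewrite g //.
have h1 : T l < T l' by apply: up_mono Us' _ _ _; lia.
have h2 : T j'.+1 < T j.+1 by apply: down_mono Ds _ _ _; lia.
lia.
Qed.

(** * Resolution reduced to coverage and innermost collisions *)

Hypothesis Tpos : forall i, 0 < i < n -> 0 < T i.

Lemma dist_eq_collision s u w : u < w -> w < n -> s < n ->
  reaches s u -> dist s u = dist s w -> collision u w.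
Proof.
move=> uw wn sn; rewrite reachesE => r E.
have [su|us] := ltnP s u.
  move: r E; rewrite !dist_up //; last by lia.
  case: ifP => // _ _; case: ifP => // U [] E.
  have : T u < T w by apply: up_mono U _ _ _; lia.
  lia.
have [su|us'] := eqVneq s u.
  move: E; rewrite su dist_self dist_up //; case: ifP => // _ [] E.
  have := Tpos (i := w); lia.
have [sw|sw] := ltnP s w; last first.
  have [E'|ne] := eqVneq s w.
    move: E r; rewrite E' dist_self dist_down //; case: ifP => // _ [] E.
    have := Tpos (i := u.+1); lia.
  move: r E; rewrite !dist_down //; try by lia.
  case: ifP => // D _; case: ifP => // _ [] E.
  have : T w.+1 < T u.+1 by apply: down_mono D _ _ _; lia.
  lia.
have us2 : u < s by lia.
move: r E; rewrite dist_down // dist_up //.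
case: ifP => // D _; case: ifP => // U [] E.
split=> //; first by lia.
by exists s; apply/and4P.
Qed.

Lemma separated_dist b j l : collision j l -> separated b j l ->
  exists s, [/\ s < n, b s & dist s j <> dist s l].
Proof.
move=> c [s [sn bs H]]; exists s; split=> // E.
have [jl ln e [c0 cc]] := c.
case/or3P: H => [/andP[sj U]|/and3P[js sl fr]|/andP[sl D]].
- move: sj; rewrite leq_eqVlt => /orP[/eqP ej|sj].
    move: E; rewrite ej dist_self dist_up; last by lia.
    case: ifP => // _ [] E; have := Tpos (i := l); lia.
  move: E; rewrite !dist_up ?U; [|lia|lia].
  case: ifP => // U' [] E.
  have : T j < T l by apply: up_mono U' _ _ _; lia.
  lia.
- move: fr; rewrite (frozen_centre c); last by lia.
  move: E; rewrite dist_down // dist_up // /centre js sl /=.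
  have [D U] := centre_edges cc.
  case/and4P: cc => ? ? ? ?.
  have : down j s || up s l.
    have [h|h] := leqP s c0; [apply/orP; left|apply/orP; right].
      by apply/downP => i ? ?; apply: D; lia.
    by apply/upP => i ? ?; apply: U; lia.
  by case: down; case: up.
- move: sl; rewrite leq_eqVlt => /orP[/eqP ej|sj].
    move: E; rewrite -ej dist_self dist_down; last by lia.
    case: ifP => // _ [] E; have := Tpos (i := j.+1); lia.
  move: E; rewrite !dist_down ?D; [|lia|lia].
  case: ifP => // U' [] E.
  have : T l.+1 < T j.+1 by apply: down_mono U' _ _ _; lia.
  lia.
Qed.

(** For the converse, a source reaching [u] either separates [u] from [w] or shows that they
    collide; the collision contains an innermost one, whose separation passes outwards. *)
Lemma resolvesE b : resolves b <->
  (forall v, v < n -> covered b v) /\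
  (forall j l, innermost j l -> separated b j l).
Proof.
split=> [R|[C S]].
  by split=> [|j l [c _]]; [case: R|exact: resolves_collision].
split=> //.
suff main u w : u < w -> w < n ->
    exists s, [/\ s < n, b s & dist s u <> dist s w].
  move=> u v un vn; case: (ltngtP u v) => // h _; first exact: main.
  by have [s [? ? ne]] := main _ _ h un; exists s; split=> // E; apply: ne.
move=> uw wn.
have [s [sn bs r]] := C u ltac:(lia).
have [E|ne] := pselect (dist s u = dist s w); last by exists s.
have c := dist_eq_collision uw wn sn r E.
have [j' [l' [I jj ll]]] := innermost_ex c.
apply: separated_dist => //.
by apply: separated_nested jj ll (S _ _ I); case: I.
Qed.

End LabelledLine.

(** * A finite automaton for resolving sets *)

Definition letter : Type := (bool * bool * bool * bool * bool)%type.
Definition astate : Type := (bool * bool * bool * bool)%type.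

(* After the vertex [v] has been read, the state [(h, p1, p2, z)] records:
   [h]: some source [s <= v] reaches [v.+1] from the left;
   [p1]: a source is still owed after [v], before or at the first vertex that
     is not falling;
   [p2]: the same, except that [v.+1] counts as falling;
   [z]: some source separates the collision opened last.
   The letter holds the type of the vertex, whether it is frozen, and whether
   an innermost collision opens or closes there. *)
Definition delta (x : letter) (q : astate) (b : bool) : option astate :=
  let: (l, g, f, s, e) := x in
  let: (h, p1, p2, z) := q in
  if [&& ~~ b, p1 & ~~ g] then None
  else let z' := z || (b && ~~ f) in
    Some (b || (l && h), ~~ b && [|| p1, p2 | ~~ h], e && ~~ z',
          if s then h || b else z').

Definition accepting (q : astate) : bool :=
  let: (_, p1, p2, _) := q in ~~ p1 && ~~ p2.

Definition start_state : astate := (false, false, false, false).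

Fixpoint arun (x : nat -> letter) (q : astate) (v : nat) (bs : seq bool) :
    option astate :=
  if bs is b :: bs' then
    if delta (x v) q b is Some q' then arun x q' v.+1 bs' else None
  else Some q.

Lemma arun_rcons x q v bs b : arun x q v (rcons bs b) =
  if arun x q v bs is Some q' then delta (x (v + size bs)) q' b else None.
Proof.
elim: bs q v => [|c bs IH] q v /=; first by rewrite addn0; case: delta.
by case: delta => // q'; rewrite IH addSnnS.
Qed.

(** * Meaning of the automaton states *)

Section Letters.
Variables (n : nat) (T : nat -> nat).

Definition opens (j : nat) : bool := `[< exists l, innermost n T j l >].
(* A collision [(j, l)] closes at [l.-1], where the obligation to find a source
   to the right becomes a [p2]; this way two successive collisions overlap in
   at most one vertex, and one bit [z] is enough. *)
Definition closes (u : nat) : bool := `[< exists j, innermost n T j u.+1 >].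
Definition letter_at (v : nat) : letter :=
  (rising T v, falling T v, frozen T v, opens v, closes v).

Variable b : nat -> bool.

(** [hit_left v] and [hit_span v] are the components [h] and [z] just before [v] is read; [pending]
    and [pending_past] say that a debt [p1] or [p2] held at that moment will be paid. *)
Fixpoint hit_left (v : nat) : bool :=
  if v is v'.+1 then b v' || (rising T v' && hit_left v') else false.

(** Opening a collision discards what was known about the previous one. By [innermost_disjoint] the
    previous one closes at the same vertex at the latest, and the closing test uses the value from
    before the reset. *)
Fixpoint hit_span (v : nat) : bool :=
  if v is v'.+1 then
    if opens v' then hit_left v' || b v'
    else hit_span v' || (b v' && ~~ frozen T v')
  else false.

Definition pending (v : nat) : Prop :=
  exists s, [/\ v <= s, s < n, b s & forall i, v <= i -> i < s -> falling T i].
Definition pending_past (v : nat) : Prop :=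
  exists s, [/\ v <= s, s < n, b s & forall i, v < i -> i < s -> falling T i].

Lemma pendingS v : v < n -> pending v <-> b v \/ (falling T v /\ pending v.+1).
Proof.
move=> vn; split=> [[s [vs sn bs H]]|[bv|[gv [s [vs sn bs H]]]]].
- have [E|ne] := eqVneq s v; first by left; rewrite -E.
  right; split; first by apply: H; lia.
  by exists s; split=> //; [lia|move=> i ? ?; apply: H; lia].
- by exists v; split=> //; lia.
- exists s; split=> //; first by lia.
  by move=> i ? ?; have [->//|ne] := eqVneq i v; apply: H; lia.
Qed.

Lemma pending_pastS v : v < n -> pending_past v <-> b v \/ pending v.+1.
Proof.
move=> vn; split=> [[s [vs sn bs H]]|[bv|[s [vs sn bs H]]]].
- have [E|ne] := eqVneq s v; first by left; rewrite -E.
  by right; exists s; split=> //; lia.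
- by exists v; split=> //; lia.
- exists s; split=> //; first by lia.
Qed.

Definition covers (v : nat) : Prop := hit_left v || b v \/ pending v.+1.
Definition separates (v : nat) : Prop :=
  closes v -> hit_span v || (b v && ~~ frozen T v) \/ pending_past v.+1.

(** The components [h] and [z] are determined by the prefix already read. The debts [p1] and [p2]
    stay arbitrary so that the induction on the suffix goes through; they become conditions on the
    sources still to come. *)
Lemma arunP bs v p1 p2 : v + size bs = n ->
  (forall i, v <= i -> i < n -> b i = nth false bs (i - v)) ->
  (exists2 q, arun letter_at (hit_left v, p1, p2, hit_span v) v bs = Some q
     & accepting q) <->
  [/\ p1 -> pending v, p2 -> pending_past v
    & forall u, v <= u -> u < n -> covers u /\ separates u].
Proof.
elim: bs v p1 p2 => [|c bs IH] v p1 p2 /=.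
  rewrite addn0 => -> _; split=> [[q [<-] /= /andP[/negPf-> /negPf->]]|].
    by split=> // u; lia.
  case=> h1 h2 _; exists (hit_left n, p1, p2, hit_span n) => //=.
  apply/andP; split; apply/negP.
    by move/h1 => -[s []]; lia.
  by move/h2 => -[s []]; lia.
move=> sz Hb; have vn : v < n by lia.
have bv : b v = c by rewrite Hb // subnn.
have Hb' i : v < i -> i < n -> b i = nth false bs (i - v.+1).
  move=> vi ni; rewrite Hb; [|lia|lia].
  by rewrite -[i - v]prednK; [rewrite subnS|lia].
set p1' := ~~ c && [|| p1, p2 | ~~ hit_left v].
set z' := hit_span v || (c && ~~ frozen T v).
have IHv := IH v.+1 p1' (closes v && ~~ z') ltac:(lia) Hb'.
rewrite /= bv in IHv.
have split_u (P : nat -> Prop) : (forall u, v <= u -> u < n -> P u) <->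
    P v /\ forall u, v < u -> u < n -> P u.
  split=> [H|[H1 H2] u vu un]; first by split=> [|u ? ?]; apply: H; lia.
  by have [->//|ne] := eqVneq u v; apply: H2; lia.
have cov : covers v <-> (c || hit_left v \/ pending v.+1).
  by rewrite /covers bv orbC.
have sep : separates v <-> (closes v -> z' \/ pending_past v.+1).
  by rewrite /separates bv.
have P1 := pendingS vn; have P2 := pending_pastS vn; rewrite bv in P1 P2.
case: ifP => [/and3P[nc p1t ng]|nfail].
  split=> [[q]//|[h1 _ _]].
  case/P1: (h1 p1t) => [h|[h _]]; first by rewrite h in nc.
  by rewrite h in ng.
rewrite IHv; split=> [[h1 h2 h3]|[h1 h2 /split_u[[h3 h4] h5]]].
  have q1 : p1' -> pending v.+1 by [].
  split.
  - move=> p1t; apply/P1; move: q1 nfail; rewrite /p1' p1t /=.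
    case: (c) => //= [_ _|H G]; first by left.
    by right; split; [case: falling G|apply: H].
  - move=> p2t; apply/P2; move: q1; rewrite /p1' p2t orbT /=.
    by case: (c) => //= H; [left|right; apply: H].
  - apply/split_u; split=> //; split.
      apply/cov; move: q1; rewrite /p1'; case: (c) => /= H; first by left.
      case hl: (hit_left v) H => H; first by left.
      by right; apply: H; rewrite !orbT.
    apply/sep => cl; move: h2; rewrite cl /=.
    by case: (z') => H; [left|right; apply: H].
split=> //.
  rewrite /p1'; case/andP => nc /or3P[p|p|p].
  - by case/P1: (h1 p) => [h|[]//]; rewrite h in nc.
  - by case/P2: (h2 p) => [h|//]; rewrite h in nc.
  - by case/cov: h3 => //; rewrite (negPf nc) (negPf p).
by case/andP => cl nz; case: ((sep.1 h4) cl) => //; rewrite (negPf nz).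
Qed.

Lemma hit_leftP v :
  reflect (exists s, [/\ s < v, b s & up T s v]) (hit_left v).
Proof.
elim: v => [|v IH] /=; first by constructor; case=> s [].
apply: (iffP orP) => [[bv|/andP[lv /IH[s [sv bs U]]]]|[s [sv bs U]]].
- by exists v; split=> //; apply/upP; lia.
- exists s; split=> //; first by lia.
  apply/upP => i si; rewrite ltnS leq_eqVlt => /orP[/eqP->//|]; exact: (upP _ _ _ U).
- have [<-|ne] := eqVneq s v; first by left.
  right; apply/andP; split; first by apply: (upP _ _ _ U); lia.
  by apply/IH; exists s; split=> //; [lia|apply: up_sub U _ _; lia].
Qed.

Lemma coversE v : v < n -> covers v <-> covered n T b v.
Proof.
move=> vn; split.
  case=> [/orP[/hit_leftP[s [sv bs U]]|bv]|[s [vs sn bs D]]].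
  - by exists s; rewrite /reaches U (ltnW sv); split=> //; lia.
  - exists v; split=> //; rewrite /reaches leqnn.
    by apply/orP; left; apply/upP; lia.
  - exists s; split=> //; rewrite /reaches (ltnW vs); apply/orP; right.
    exact/downP.
case=> s [sn bs /orP[/andP[sv U]|/andP[vs D]]].
  left; have [<-|ne] := eqVneq s v; first by rewrite bs orbT.
  by apply/orP; left; apply/hit_leftP; exists s; split=> //; lia.
have [<-|ne] := eqVneq s v; first by left; rewrite bs orbT.
right; exists s; split=> //; first by lia.
exact/downP.
Qed.

(** The bit is not reset before [l.-1], because by [innermost_disjoint] the next innermost collision
    opens there at the earliest. *)
Lemma hit_spanP j l v : innermost n T j l -> j < v -> v < l ->
  hit_span v <->
  (exists s, [/\ b s, s <= j & up T s j]) \/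
  (exists s, [/\ b s, j < s, s < v & ~~ frozen T s]).
Proof.
move=> I; elim: v => // v IH jv vl /=.
have [E|ne] := eqVneq v j.
  subst v; rewrite (_ : opens j); last by apply/asboolP; exists l.
  split=> [/orP[/hit_leftP[s [sj bs U]]|bj]|[[s [bs sj U]]|[s []]]].
  - by left; exists s; split=> //; lia.
  - by left; exists j; split=> //; apply/upP; lia.
  - have [<-|ne] := eqVneq s j; first by rewrite bs orbT.
    by apply/orP; left; apply/hit_leftP; exists s; split=> //; lia.
  - lia.
rewrite (_ : opens v = false); last first.
  apply/negP => /asboolP[l' I'].
  have := innermost_disjoint I I'; lia.
have {}IH := IH ltac:(lia) ltac:(lia).
split=> [/orP[/IH[h|[s [bs js sv f]]]|/andP[bv f]]|[h|[s [bs js sv f]]]].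
- by left.
- by right; exists s; split=> //; lia.
- by right; exists v; split=> //; lia.
- by apply/orP; left; apply/IH; left.
- have [<-|ne'] := eqVneq s v; first by rewrite bs f orbT.
  by apply/orP; left; apply/IH; right; exists s; split=> //; lia.
Qed.

Lemma separatesE : (forall v, v < n -> separates v) <->
  (forall j l, innermost n T j l -> separated n T b j l).
Proof.
split=> [H j l I|H v vn /asboolP[j I]].
  have [[jl ln _ _] _] := I.
  have cl : closes l.-1 by apply/asboolP; exists j; rewrite prednK //; lia.
  have := H l.-1 ltac:(lia) cl; rewrite prednK; last by lia.
  have HS := @hit_spanP j l l.-1 I ltac:(lia) ltac:(lia).
  case=> [/orP[/HS[]|/andP[bs f]]|].
  - case=> s [bs sj U]; exists s; split=> //; [lia|].
    by rewrite sj U.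
  - case=> s [bs js sl f]; exists s; split=> //; [lia|].
    by apply/or3P/Or32; apply/and3P; split=> //; lia.
  - exists l.-1; split=> //; [lia|].
    by apply/or3P/Or32; apply/and3P; split=> //; lia.
  - case=> s [ls sn bs D]; exists s; split=> //.
    by apply/or3P/Or33; rewrite ls; apply/downP.
have [[jl ln _ _] _] := I.
have [s [sn bs]] := H _ _ I.
case/or3P => [/andP[sj U]|/and3P[js sl f]|/andP[ls D]].
- left; apply/orP; left; apply/(hit_spanP I); [lia|lia|].
  by left; exists s.
- left; apply/orP; have [<-|ne] := eqVneq s v; first by right; rewrite bs f.
  left; apply/(hit_spanP I); [lia|lia|].
  by right; exists s; split=> //; lia.
- by right; exists s; split=> //; apply/downP.
Qed.

End Letters.

Lemma automaton_correct n T bs :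
  (forall i, 0 < i < n -> 0 < T i) -> size bs = n ->
  (exists2 q, arun (letter_at n T) start_state 0 bs = Some q & accepting q) <->
  resolves n T (nth false bs).
Proof.
move=> Tpos sz; rewrite (resolvesE Tpos) -separatesE.
have := @arunP n T (nth false bs) bs 0 false false sz.
move=> /(_ (fun i _ _ => ltac:(by rewrite subn0))) ->.
split=> [[_ _ H]|[H1 H2]].
  split=> v vn; [apply/(coversE _ _ vn)|]; by case: (H v isT vn).
split=> // u _ un; split; last exact: H2.
exact/(coversE _ _ un)/H1.
Qed.

(** * Temporal paths as labelled lines *)

Section Line.
Variables (n : nat) (G : tgraph 'I_n).

Definition edge (pos : nat -> 'I_n) (i : nat) : {set 'I_n} :=
  [set pos i.-1; pos i].

Record line_of (pos : nat -> 'I_n) (T : nat -> nat) : Prop := LineOf {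
  pos_inj : forall i j, i < n -> j < n -> pos i = pos j -> i = j;
  pos_surj : forall v, exists2 i, i < n & pos i = v;
  edgesE : forall e,
    e \in edges G <-> exists2 i, 0 < i < n & e = edge pos i;
  labelsE : forall i t, 0 < i < n ->
    (t \in labels G (edge pos i)) = (t == T i);
  label_out : forall i, ~~ (0 < i < n) -> T i = 0 }.

Lemma line_ex : temporal_path G -> one_labeling G ->
  exists pos T, line_of pos T.
Proof.
move=> [x [p [U cov E]]] one.
have sz : size (x :: p) = n.
  rewrite -[RHS]card_ord -(card_uniqP U); apply: eq_card => v.
  by rewrite cov.
pose pos := nth x (x :: p).
(* The label set of an edge is a singleton, so the sum extracts its only element. *)
pose T i := if 0 < i < n then \sum_(t <- labels G (edge pos i)) t else 0.
have edgesP e : reflect (exists2 i, 0 < i < n & e = edge pos i)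
    (e \in edges G).
  have szp : size p = n.-1 by move: sz => /=; lia.
  rewrite E inE; apply: (iffP (nthP set0)).
    move=> [i]; rewrite size_pairmap szp => ip.
    rewrite (nth_pairmap x) ?szp // => <-.
    by exists i.+1; [lia|].
  move=> [[|i] // i0 ->]; exists i; first by rewrite size_pairmap; lia.
  by rewrite (nth_pairmap x) //; lia.
exists pos, T; split.
- by move=> i j iN jN /eqP; rewrite nth_uniq ?sz // => /eqP.
- move=> v; exists (index v (x :: p)); first by move: (cov v); rewrite -index_mem sz.
  by rewrite /pos nth_index ?cov.
- by move=> e; split=> /edgesP.
- move=> i t i0; rewrite /T i0.
  have eE : edge pos i \in edges G by apply/edgesP; exists i.
  move: (one _ eE) (labels_neq0 eE).
  rewrite -cardfs_gt0 => le1 gt0.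
  have /cardfs1P[a ->] : #|` labels G (edge pos i)| == 1 by rewrite eqn_leq le1.
  by rewrite in_fset1 big_seq_fset1.
- by move=> i; rewrite /T => /negPf ->.
Qed.

(** The symmetry behind two later reductions: movement to the left is movement to the right on the
    reversed line, and the program may start its walk at either end. *)
Lemma line_rev pos T : line_of pos T ->
  line_of (fun i => pos (n.-1 - i)) (fun i => T (n - i)).
Proof.
move=> [inj surj Es Ls out].
have edge_rev i : 0 < i < n -> edge (fun i => pos (n.-1 - i)) i = edge pos (n - i).
  move=> i0; rewrite /edge setUC; congr [set pos _; pos _]; lia.
split.
- by move=> i j ni nj /inj; lia.
- by move=> v; have [i ni <-] := surj v; exists (n.-1 - i); [|congr pos]; lia.
- move=> e; rewrite Es; split=> -[i i0 ->]; exists (n - i); try by lia.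
    by rewrite edge_rev; [congr edge|]; lia.
  by rewrite edge_rev.
- by move=> i t i0; rewrite edge_rev // Ls //; lia.
- by move=> i i0; apply: out; lia.
Qed.

Section Oriented.
Variables (pos : nat -> 'I_n) (T : nat -> nat).
Hypothesis L : line_of pos T.

Lemma label_pos i : 0 < i < n -> 0 < T i.
Proof.
move=> i0; apply: (@labels_pos _ G (edge pos i)).
  by apply/(edgesE L); exists i.
by rewrite (labelsE L).
Qed.

Lemma mem_edge i v : 0 < i < n -> v < n ->
  (pos v \in edge pos i) = (v.+1 == i) || (v == i).
Proof.
move=> i0 vn; rewrite !inE; congr orb; apply/eqP/eqP => [/(pos_inj L)|].
- by move=> /(_ vn ltac:(lia)); lia.
- by move=> <-.
- by move=> /(_ vn ltac:(lia)).
- by move=> <-.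
Qed.

Lemma edge_inj i j : 0 < i < n -> 0 < j < n -> edge pos i = edge pos j -> i = j.
Proof.
move=> i0 j0 E.
have := mem_edge (v := i) i0 ltac:(lia).
have := mem_edge (v := i.-1) i0 ltac:(lia).
rewrite E !mem_edge //; lia.
Qed.

Lemma step_edge i t0 y t : i < n -> journey_step G (pos i, t0) (y, t) ->
  t0 < t /\ ((i.+1 < n /\ (y, t) = (pos i.+1, T i.+1)) \/
             (0 < i /\ y = pos i.-1)).
Proof.
move=> ni /and3P[/= e lab lt]; split=> //.
have c2 := edges_card2 e.
have ne : pos i != y.
  by apply/eqP => E; move: c2; rewrite E setUid cards1.
have /(edgesE L) [m m0 E] := e.
have : pos i \in edge pos m by rewrite -E !inE eqxx.
rewrite mem_edge // => /orP[/eqP im|/eqP im].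
  left; subst m; split; first by lia.
  have : y \in edge pos i.+1 by rewrite -E !inE eqxx orbT.
  rewrite !inE /= eq_sym (negPf ne) /= => /eqP Ey.
  by move: lab; rewrite E (labelsE L) // => /eqP ->; rewrite Ey.
right; subst m; split; first by lia.
have : y \in edge pos i by rewrite -E !inE eqxx orbT.
by rewrite !inE /= orbC eq_sym (negPf ne) /= => /eqP.
Qed.

Definition walk (s r : nat) : seq ('I_n * nat) :=
  [seq (pos k, T k) | k <- iota s.+1 r].

(** A journey that has just moved right can never turn back, since the next step would repeat
    [pos i.-1]; this is why the vertex just left is kept in the [uniq] hypothesis. *)
Lemma journey_right i t0 js : 0 < i < n ->
  path (journey_step G) (pos i, t0) js ->
  uniq [:: pos i.-1, pos i & unzip1 js] ->
  exists r, [/\ i + r < n, js = walk i r, 0 < r -> t0 < T i.+1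
    & forall k, i < k -> k < i + r -> T k < T k.+1].
Proof.
elim: js i t0 => [|[y t] js IH] i t0 i0.
  by move=> _ _; exists 0; split=> //; lia.
move=> /= /andP[st pth] /and3P[nin].
have [t0t [[i1 [Ey Et]]|[_ E]]] := step_edge (i := i) ltac:(lia) st; last first.
  by move: nin; rewrite E !inE eqxx orbT.
subst y t; move=> nin2 U.
have [||r [rn -> h1 h2]] := IH i.+1 (T i.+1) _ pth _; first by lia.
  by rewrite /= nin2.
exists r.+1; split=> //; first by lia.
move=> k ik kr; have [E|ne] := eqVneq k i.+1; last by apply: h2; lia.
by rewrite E; apply: h1; lia.
Qed.

Lemma walk_path i t0 r : i + r < n -> (0 < r -> t0 < T i.+1) ->
  (forall k, i < k -> k < i + r -> T k < T k.+1) ->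
  path (journey_step G) (pos i, t0) (walk i r).
Proof.
elim: r i t0 => // r IH i t0 ir h0 h; rewrite /walk /=; apply/andP; split.
  have i0 : 0 < i.+1 < n by lia.
  apply/and3P; split; last exact: h0.
    by apply/(edgesE L); exists i.+1.
  by rewrite [[set _; _]](_ : _ = edge pos i.+1) // (labelsE L).
apply: IH; first by lia.
  by move=> r0; apply: h; lia.
by move=> k ik kr; apply: h; lia.
Qed.

Lemma unzip1_walk i r : unzip1 (walk i r) = [seq pos k | k <- iota i.+1 r].
Proof. by rewrite /unzip1 -map_comp. Qed.

Lemma unzip2_walk i r : unzip2 (walk i r) = [seq T k | k <- iota i.+1 r].
Proof. by rewrite /unzip2 -map_comp. Qed.

Lemma last_iota i r : last i (iota i.+1 r) = i + r.
Proof. by elim: r i => [|r IH] i /=; rewrite ?addn0 // IH addSnnS. Qed.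

End Oriented.
End Line.

(** * Transfer of distances and resolving sets to the line *)

Lemma tdist_unique (V : finType) (G : tgraph V) u v (P : bool) t0 :
  (forall t, arrives G u v t <-> P /\ t = t0) ->
  tdist G u v = if P then Some t0 else None.
Proof.
move=> H; rewrite /tdist; case: pselect => [h|h].
  case: ex_minnP => m /asboolP/H [-> ->] //.
case: ifP => // p; case: h; exists t0; apply/asboolP; exact/H.
Qed.

Lemma arrives_tdist (V : finType) (G : tgraph V) u v :
  reachable G u v <-> tdist G u v <> None.
Proof.
rewrite /tdist; case: pselect => [h|h]; split=> //.
  by move=> _; case: h => t /asboolP[s j _]; exists s.
by case=> s j; case: h; exists (last 0 (unzip2 s)); apply/asboolP; exists s.
Qed.

Section Distances.
Variables (n : nat) (G : tgraph 'I_n).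

Lemma tdist_up pos T s v : line_of G pos T -> s < v -> v < n ->
  tdist G (pos s) (pos v) = if up T s v then Some (T v) else None.
Proof.
move=> L sv vn; apply: tdist_unique => t; split; last first.
  move=> [/upP U ->].
  have H k : s < k -> k < s + (v - s) -> T k < T k.+1.
    by move=> sk kv; have := U k sk ltac:(lia); case/andP.
  have Lpos : 0 < T s.+1 by apply: (label_pos L); lia.
  have ev : s + (v - s) = v by lia.
  exists (walk pos T s (v - s)).
    apply/and3P; split; first by apply: (walk_path L) => //; lia.
      rewrite unzip1_walk -[_ :: _]/(map pos (s :: iota s.+1 (v - s))).
      rewrite map_inj_in_uniq.
        by rewrite -[_ :: _]/(iota s (v - s).+1) iota_uniq.
      move=> i j; rewrite -[_ :: _]/(iota s (v - s).+1) !mem_iota => hi hj.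
      by apply: (pos_inj L); lia.
    by rewrite unzip1_walk last_map last_iota ev.
  rewrite unzip2_walk.
  have -> : v - s = (v - s).-1.+1 by lia.
  by rewrite /= last_map last_iota; congr T; lia.
case=> -[|[y t1] js]; rewrite /journey /=.
  by move/eqP/(pos_inj L) => /(_ ltac:(lia) vn); lia.
move=> /and3P[/andP[st pth] U la] lt.
have [_ [[s1 [Ey Et]]|[s0 E]]] := step_edge L (i := s) ltac:(lia) st.
  subst y t1.
  have [|r [rn Ejs h1 h2]] := journey_right L _ pth U; first by lia.
  move: la lt; rewrite Ejs unzip1_walk unzip2_walk !last_map !last_iota.
  move/eqP/(pos_inj L) => /(_ rn vn) <- <-; split=> //.
  apply/upP => i si ir; apply/andP; split; first by lia.
  have [->|ne] := eqVneq i s.+1; last by apply: h2; lia.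
  by apply: h1; lia.
(* The first step went left. On the reversed line it is a step to the right, so the journey moves
   away from [pos v] for good. *)
have L' := line_rev L; subst y.
set pos' := fun i => _ in L'.
have e1 : pos s.-1 = pos' (n - s) by rewrite /pos'; congr pos; lia.
have e2 : pos s = pos' (n - s).-1 by rewrite /pos'; congr pos; lia.
rewrite e1 in pth U la; rewrite e2 in U.
have [|r [rn Ejs h1 h2]] := journey_right L' _ pth U; first by lia.
move: la; rewrite Ejs unzip1_walk !last_map !last_iota.
by move/eqP/(pos_inj L) => /(_ ltac:(lia) vn); lia.
Qed.

Lemma tdistE pos T s v : line_of G pos T -> s < n -> v < n ->
  tdist G (pos s) (pos v) = dist T s v.
Proof.
move=> L sn vn; case: (ltngtP s v) => [sv|vs|->].
- by rewrite dist_up // (tdist_up L).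
- rewrite dist_down //; have L' := line_rev L.
  have -> : pos s = pos (n.-1 - (n.-1 - s)) by congr pos; lia.
  have -> : pos v = pos (n.-1 - (n.-1 - v)) by congr pos; lia.
  rewrite (tdist_up L'); [|lia|lia].
  rewrite (_ : n - (n.-1 - v) = v.+1); last by lia.
  congr (if _ then _ else _); apply/upP/downP => H i vi si.
    have := H (n.-1 - i) ltac:(lia) ltac:(lia).
    rewrite /rising /falling => /andP[_].
    have -> : n - (n.-1 - i) = i.+1 by lia.
    by have -> : n - (n.-1 - i).+1 = i by lia.
  have := H (n.-1 - i) ltac:(lia) ltac:(lia).
  rewrite /rising /falling.
  have -> : (n.-1 - i).+1 = n - i by lia.
  have -> : n.-1 - i = n - i.+1 by lia.
  by lia.
- rewrite dist_self (@tdist_unique _ _ _ _ true 0) // => t.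
  split=> [[[|a js] /and3P[_ U la] <- //]|[_ ->]]; last first.
    by exists [::] => //; rewrite /journey /= eqxx.
  by move: U; rewrite -(eqP la) /= mem_last.
Qed.

Lemma card_ord_count (P : pred nat) :
  #|[set i : 'I_n | P i]| = count P (iota 0 n).
Proof.
by rewrite cardsE cardE size_filter -enumT -val_enum_ord count_map.
Qed.

Lemma resolving_line pos T k : line_of G pos T ->
  has_temporal_resolving_set G k <->
  exists bs, [/\ size bs = n, resolves n T (nth false bs) & count id bs <= k].
Proof.
move=> L; have D s v := tdistE (s := s) (v := v) L.
have reachE s v : s < n -> v < n -> reachable G (pos s) (pos v) <-> reaches T s v.
  move=> sn vn; rewrite reachesE arrives_tdist D //.
  by split=> [/eqP|/eqP].
split=> [[R [Rc Rs] Rk]|[bs [sz [C S] ck]]].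
  pose bs := [seq pos i \in R | i <- iota 0 n].
  have bsE i : i < n -> nth false bs i = (pos i \in R).
    by move=> ni; rewrite (nth_map 0) ?size_iota // nth_iota.
  exists bs; split; first by rewrite size_map size_iota.
    split=> [v vn|u v un vn uv].
      have [s sR r] := Rc (pos v); have [i ni E] := pos_surj L s; subst s.
      by exists i; rewrite bsE // sR; split=> //; apply/reachE.
    have [|s sR r] := Rs (pos u) (pos v).
      by apply: contra_neq uv; exact: (pos_inj L).
    have [i ni E] := pos_surj L s; subst s.
    by exists i; rewrite bsE // sR -!D.
  rewrite (leq_trans _ Rk) // /bs count_map -card_ord_count.
  rewrite -(card_in_imset (f := fun i : 'I_n => pos i)).
    by apply/subset_leq_card/subsetP => v /imsetP[i]; rewrite inE /= => ? ->.
  by move=> i j _ _ /(pos_inj L) => /(_ (ltn_ord i) (ltn_ord j)) /val_inj.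
exists [set pos i | i : 'I_n in [set i : 'I_n | nth false bs i]].
  split=> [v|u v uv].
    have [j nj E] := pos_surj L v; subst v.
    have [i [ni bi r]] := C j nj; exists (pos i); last exact/reachE.
    by apply/imsetP; exists (Ordinal ni); rewrite // inE.
  have [i ni E] := pos_surj L u; subst u.
  have [j nj E] := pos_surj L v; subst v.
  have [|s [sn bs' d]] := S i j ni nj.
    by apply: contra_neq uv => ->.
  exists (pos s); last by rewrite !D.
  by apply/imsetP; exists (Ordinal sn); rewrite // inE.
rewrite (leq_trans (leq_imset_card _ _)) // (leq_trans _ ck) //.
rewrite (@card_ord_count (nth false bs)).
rewrite -[X in _ <= count _ X](mkseq_nth false bs) sz count_map.
by apply: eq_leq; apply: eq_count.
Qed.

End Distances.

(** * Searching for the innermost collisions *)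

Section Valleys.
Variables (n : nat) (T : nat -> nat).
Notation rising := (rising T).
Notation falling := (falling T).
Notation level := (level T).
Notation collision := (collision n T).
Notation innermost := (innermost n T).
Notation centre := (centre T).

(* The state of the two-pointer search from the bottom [d]: the edges [a] on the
   left and [v] on the right are compared next, and no earlier pair matched. *)
Record valley (a d v : nat) : Prop := Valley {
  valley_a0 : 0 < a;
  valley_ad : a < d;
  valley_dv : d < v;
  valley_gt : forall x, a <= x -> x < d -> falling x;
  valley_lt : forall x, d <= x -> x < v -> rising x;
  valley_left : T a.+1 < T v;
  valley_right : T v.-1 < T a;
  valley_neq : forall x y, a < x -> x < d -> d < y -> y < v -> T x <> T y }.

(** The invariant while no search is running: every innermost collision still to end belongs to a
    bottom that has not been scanned. *)
Definition settled (v : nat) : Prop :=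
  forall j l, innermost j l -> v < l -> exists2 s, v <= s & centre j l s.

Lemma valley_down a d v : valley a d v -> down T a.-1 d.
Proof. by case=> _ _ _ g _ _ _ _; apply/downP => i ? ?; apply: g; lia. Qed.

Lemma valley_up a d v : valley a d v -> up T d.-1 v.
Proof. by case=> _ _ _ _ l _ _ _; apply/upP => i ? ?; apply: l; lia. Qed.

Lemma valley_start v : T 0 = 0 -> falling v.-1 -> rising v -> valley v.-1 v v.+1.
Proof.
move=> T0 g l; have v1 : 0 < v.-1.
  by case: (posnP v.-1) g => // ->; rewrite falling0F.
have ev : v.-1.+1 = v by lia.
split=> //.
- lia.
- by move=> x ? ?; have -> : x = v.-1 by lia.
- by move=> x ? ?; have -> : x = v by lia.
- by rewrite ev; case/andP: l.
- by move: g; rewrite /falling ev.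
- lia.
Qed.

(** The centre must be [d.-1] or [d]: it cannot come before the falling vertex [d.-1], nor after
    [d], where the vertices rise. Either way [d] itself can serve as the bottom. *)
Lemma valley_centre d v j l s : collision j l -> centre j l s ->
  falling d.-1 -> (forall x, d <= x -> x < v -> rising x) ->
  d < v -> s < v -> v <= l ->
  [/\ j.+1 < d, down T j d & up T d.-1 l].
Proof.
move=> [jl ln e _] /and4P[js sl /downP D /upP U] g lts dv sv vl.
have ld : rising d by apply: lts; lia.
have d0 : 0 < d by case/andP: ld.
have Ud : up T d.-1 l.
  by apply/upP => i ? ?; have [iv|vi] := ltnP i v; [apply: lts|apply: U]; lia.
have ds : d.-1 <= s.
  rewrite leqNgt; apply/negP => sd.
  by have /rising_fallingF := U d.-1 sd ltac:(lia); rewrite g.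
have sd : s <= d.
  rewrite leqNgt; apply/negP => sd.
  have [jd|dj] := ltnP j d.
    by have := D d jd sd; rewrite rising_fallingF.
  suff : T j.+1 < T l by lia.
  by apply: up_mono Ud _ _ _; lia.
have Dd : down T j d.
  apply/downP => i ? ?; have [->//|ne] := eqVneq i d.-1.
  by apply: D; lia.
split=> //.
have jd : j < d by lia.
rewrite ltn_neqAle jd andbT; apply/eqP => E.
suff : T j.+1 < T l by lia.
by apply: up_mono Ud _ _ _; lia.
Qed.

Lemma valley_centre' a d v j l s : valley a d v -> collision j l ->
  centre j l s -> s < v -> v <= l ->
  [/\ j.+1 < d, down T j d & up T d.-1 l].
Proof.
move=> [a0 ad dv g lts _ _ _] c cc sv vl.
apply: valley_centre c cc _ lts dv sv vl.
by apply: g; lia.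
Qed.

(** The step of a merge: the right labels before [v] are below [T a] and [T v] is above it, so the
    edge [a] has no partner among those seen and can be passed. *)
Lemma valley_move_left a d v : T 0 = 0 -> valley a d v -> T a < T v ->
  falling a.-1 -> valley a.-1 d v.
Proof.
move=> T0 V lav g; have [a0 ad dv gs lts hl hr ne] := V.
have a1 : 0 < a.-1.
  by case: (posnP a.-1) g => // ->; rewrite falling0F.
split=> //; try by lia.
- by move=> x ? ?; have [->//|ne'] := eqVneq x a.-1; apply: gs; lia.
- by rewrite prednK.
- by move: g; rewrite /falling prednK //; lia.
- move=> x y ax xd dy yv; have [Ex|ne'] := eqVneq x a; last by apply: ne; lia.
  rewrite Ex; suff : T y <= T v.-1 by lia.
  have [->//|ne''] := eqVneq y v.-1.
  by apply/ltnW/(up_mono (valley_up V)); lia.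
Qed.

Lemma valley_move_right a d v : valley a d v -> T v < T a -> rising v ->
  valley a d v.+1.
Proof.
move=> V lva lv; have [a0 ad dv gs lts hl hr ne] := V.
split=> //; try by lia.
- by move=> x ? ?; have [->//|ne'] := eqVneq x v; apply: lts; lia.
- by case/andP: lv; lia.
- move=> x y ax xd dy yv; have [Ey|ne'] := eqVneq y v; last by apply: ne; lia.
  rewrite Ey; suff : T x <= T a.+1 by lia.
  have [->//|ne''] := eqVneq x a.+1.
  by apply/ltnW/(down_mono (valley_down V)); lia.
Qed.

Lemma valley_pass a d v j : valley a d v -> T v < T a -> ~ innermost j v.
Proof.
move=> V lva [c _]; have [jl ln e [s cc]] := c.
have /and4P[js sv _ _] := cc.
have [jd D U] := valley_centre' V c cc sv (leqnn v).
have [a0 ad dv gs lts hl hr ne] := V.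
have [ja|aj] := leqP j.+1 a.
  have [E|ne'] := eqVneq j.+1 a; first by rewrite -E in lva; lia.
  have : T a < T j.+1 by apply: (down_mono D); lia.
  lia.
have [E|ne'] := eqVneq j a; first by rewrite E in e; lia.
have : T j.+1 < T a.+1 by apply: (down_mono (valley_down V)); lia.
lia.
Qed.

(** The left side ends at the edge [a], whose label is its largest and still below [T v]; hence no
    edge from [v] on can match it. *)
Lemma valley_stop a d v j l : valley a d v -> T a < T v -> ~~ falling a.-1 ->
  innermost j l -> v <= l -> exists2 s, v <= s & centre j l s.
Proof.
move=> V lav ng [c _] vl; have [jl ln e [s cc]] := c.
have [vs|sv] := leqP v s; first by exists s.
have [jd D U] := valley_centre' V c cc sv vl.
have [a0 ad dv gs lts hl hr ne] := V.
have aj : a.-1 <= j.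
  rewrite leqNgt; apply/negP => ja; case/negP: ng.
  by apply: (downP _ _ _ D); lia.
have h1 : T j.+1 <= T a.
  have [->//|ne'] := eqVneq j.+1 a.
  by apply/ltnW/(down_mono (valley_down V)); lia.
have h2 : T v <= T l.
  by have [->//|ne'] := eqVneq v l; apply/ltnW/(up_mono U); lia.
lia.
Qed.

(** A match strictly inside is excluded by [valley_neq], and one sharing an end by the strict
    monotonicity of the two sides. *)
Lemma valley_found a d v : v < n -> valley a d v -> T a = T v ->
  innermost a.-1 v.
Proof.
move=> vn V e; have [a0 ad dv gs lts hl hr ne] := V.
have ea : a.-1.+1 = a by lia.
have Dv := valley_down V; have Uv := valley_up V.
split.
  split; [lia|by []|by rewrite ea|].
  exists d; apply/and4P; split=> //; first by lia.
  by apply: up_sub Uv _ _; lia.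
move=> j l aj lv c; have [jl ln e' [s cc]] := c.
have /and4P[js sl D U] := cc.
have dl : d < l.
  rewrite ltnNge; apply/negP => ld; suff : T l < T j.+1 by lia.
  by apply: (down_mono Dv); lia.
have jd : j.+1 < d.
  rewrite ltnNge; apply/negP => dj; suff : T j.+1 < T l by lia.
  by apply: (up_mono Uv); lia.
have [El|nl] := eqVneq l v.
  subst l; split=> //.
  have [Ej|nj] := eqVneq j.+1 a; first by lia.
  have : T j.+1 < T a by apply: (down_mono Dv); lia.
  lia.
have [Ej|nj] := eqVneq j.+1 a.
  have : T l < T v by apply: (up_mono Uv); lia.
  by move: e'; rewrite Ej; lia.
by case: (@ne j.+1 l) => //; lia.
Qed.

(** Justifies ending the search at the first match: any later collision with the same bottom
    contains the pair just found. *)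
Lemma valley_found_uniq a d v j l : v < n -> valley a d v -> T a = T v ->
  innermost j l -> v <= l ->
  (exists2 s, v <= s & centre j l s) \/ (j = a.-1 /\ l = v).
Proof.
move=> vn V e [c I] vl; have [jl ln e' [s cc]] := c.
have [vs|sv] := leqP v s; [by left; exists s|right].
have [jd D U] := valley_centre' V c cc sv vl.
have [a0 ad dv gs lts hl hr ne] := V.
have [c' _] := valley_found vn V e.
have ja : j <= a.-1.
  rewrite leqNgt; apply/negP => aj.
  have h1 : T j.+1 < T a by apply: (down_mono (valley_down V)); lia.
  have : T v <= T l.
    by have [->//|nl] := eqVneq v l; apply/ltnW/(up_mono U); lia.
  lia.
by have [-> ->] := I _ _ ja vl c'.
Qed.

Lemma falling_no_collision v j : falling v -> ~ collision j v.+1.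
Proof.
move=> g [jl ln e [s cc]]; have /and4P[js sl D U] := cc.
have [E|ne] := eqVneq s v.
  by have [] := centre_falling e cc; rewrite ?E //; lia.
by have := upP _ _ _ U v ltac:(lia) ltac:(lia); move/rising_fallingF; rewrite g.
Qed.

(** A falling [v] cuts off the right side of every earlier valley, and if [v] itself is a centre, so
    is [v.+1]. A running search may therefore be dropped. *)
Lemma settled_falling v : falling v -> settled v.+1.
Proof.
move=> g j l [c _] vl; have [jl ln e [s cc]] := c.
have /and4P[js sl D U] := cc.
have [vs|sv] := ltnP v s; first by exists s.
have [E|ne] := eqVneq s v.
  by exists v.+1 => //; apply: centre_shiftr; rewrite // -E.
by have := upP _ _ _ U v ltac:(lia) ltac:(lia); move/rising_fallingF; rewrite g.
Qed.

(** The two edges at a level vertex match at once, so no search is started there. *)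
Lemma level_collision v : level v -> v.+1 < n -> innermost v.-1 v.+1.
Proof.
move=> ev vn; have /andP[v0 /eqP e] := ev.
split.
  split=> //; [lia|by rewrite prednK|].
  by exists v; apply/and4P; split; try lia; [apply/downP|apply/upP]; lia.
by move=> j l ? ? [? _ _ _]; lia.
Qed.

Lemma level_innermost v j l : level v -> innermost j l -> v < l ->
  (exists2 s, v < s & centre j l s) \/ (j = v.-1 /\ l = v.+1).
Proof.
move=> ev [c I] vl; have [jl ln e [s cc]] := c.
have /and4P[js sl D U] := cc.
have [vs|sv] := ltnP v s; [by left; exists s|right].
have [E|ne] := eqVneq s v; last first.
  by have := upP _ _ _ U v ltac:(lia) ltac:(lia); rewrite (levelF ev).
subst s; have [c' _] := level_collision ev ltac:(lia).
by have [-> ->] := I v.-1 v.+1 ltac:(lia) vl c'.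
Qed.

Lemma settled_rising v : settled v -> rising v -> ~~ falling v.-1 ->
  settled v.+1 /\ forall j, ~ innermost j v.+1.
Proof.
move=> S lv ng.
have H j l : innermost j l -> v < l -> exists2 s, v < s & centre j l s.
  move=> I vl; have [[jl ln e _] _] := I.
  have [s vs cc] := S _ _ I vl; exists s => //.
  rewrite ltn_neqAle vs andbT; apply/eqP => E; subst s.
  by have [_] := centre_rising e cc lv; rewrite (negPf ng).
split=> [j l I vl|j I]; first by apply: H => //; lia.
by have [s vs /and4P[]] := H _ _ I (leqnn _); lia.
Qed.

End Valleys.

(** * The scanning program *)

(* Array 4 holds the positions in the input of the labels [T 0], ..., [T n].
   Variables 6, 7, 8 hold the vertex to be classified, which is also the right
   pointer, the left pointer, and whether a search is running.  Arrays 5 to 9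
   receive the components of the letters: rising, falling, frozen, opens,
   closes. *)
Definition c0 := Const 0.
Definition c1 := Const 1.

(** Whether [v.-1] is frozen can depend on [v] rising, so that mark is written one step late,
    together with the one for [v], when a new bottom is met. *)
Definition classify : cmd :=
  If (LabelLt (Get 4 (Var 6)) (Get 4 (Succ (Var 6))))
    (Seq (Put 5 (Var 6) c1)
      (If (Lt c0 (Get 6 (Pred (Var 6))))
        (seqs [:: Put 7 (Pred (Var 6)) c1; Put 7 (Var 6) c1;
                  Assign 7 (Pred (Var 6)); Assign 8 c1])
        Skip))
    (If (LabelLt (Get 4 (Succ (Var 6))) (Get 4 (Var 6)))
      (Seq (Put 6 (Var 6) c1) (Assign 8 c0))
      (seqs [:: Put 7 (Var 6) c1; Put 8 (Pred (Var 6)) c1; Put 9 (Var 6) c1;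
                Assign 8 c0])).

(** Each round makes one constant-time move: a step of the left pointer, the end of a search, a
    recorded match, or an advance of variable 6. Without an inner loop a single potential accounts
    for both pointers. Equality of labels is the failure of both comparisons. *)
Definition scan_body : cmd :=
  If (And (Lt c0 (Var 8)) (LabelLt (Get 4 (Var 7)) (Get 4 (Var 6))))
    (If (Lt c0 (Get 6 (Pred (Var 7))))
      (Assign 7 (Pred (Var 7)))
      (Assign 8 c0))
    (If (And (Lt c0 (Var 8))
             (Not (LabelLt (Get 4 (Var 6)) (Get 4 (Var 7)))))
      (seqs [:: Put 8 (Pred (Var 7)) c1; Put 9 (Pred (Var 6)) c1;
                Assign 8 c0])
      (Seq classify (Assign 6 (Succ (Var 6))))).

Definition scan_test : test := Lt (Var 6) (Var 0).

(** Vertex 0 is neither rising, falling nor level, by the sentinel and the tests [0 < v], so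
    classification can begin at 1. *)
Definition scan : cmd := Seq (Assign 6 c1) (While scan_test scan_body).

Section Scan.
Variables (n k : nat) (T : nat -> nat) (lab : seq nat).
Hypothesis n0 : 0 < n.
Hypothesis Tout : forall i, ~~ (0 < i < n) -> T i = 0.
Hypothesis Tpos : forall i, 0 < i < n -> 0 < T i.

Definition labels_in (st : state) : Prop :=
  [/\ vars st 0 = n, vars st 1 = k
    & forall i, i <= n -> nth 0 lab (arrs st 4 i) = T i].

Definition frozen_upto (v x : nat) : bool :=
  [|| (x < v) && level T x, [&& falling T x, rising T x.+1 & x.+1 < v]
    | [&& rising T x, falling T x.-1 & x < v]].

(** While a search runs, variable 8 is 1 and a collision ending exactly at the right pointer is
    still undecided; adding it to [l] turns [l <= v] into [l < v]. *)
Record scan_inv (st : state) : Prop := ScanInv {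
  inv_labels : labels_in st;
  inv_v : 0 < vars st 6 <= n;
  inv_act : vars st 8 <= 1;
  inv_lt : forall x, arrs st 5 x = ((x < vars st 6) && rising T x);
  inv_gt : forall x, arrs st 6 x = ((x < vars st 6) && falling T x);
  inv_fr : forall x, arrs st 7 x = frozen_upto (vars st 6) x;
  inv_opens : forall x, 0 < arrs st 8 x <->
    exists2 l, innermost n T x l & l + vars st 8 <= vars st 6;
  inv_closes : forall x, 0 < arrs st 9 x <->
    exists2 j, innermost n T j x.+1 & x.+1 + vars st 8 <= vars st 6;
  inv_settled : vars st 8 = 0 -> settled n T (vars st 6);
  inv_valley : vars st 8 = 1 ->
    exists d, valley T (vars st 7) d (vars st 6) }.

(* The number of left moves available to the search from the bottom [v]. *)
Fixpoint fall_run (v : nat) : nat :=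
  if v is v'.+1 then if falling T v' then (fall_run v').+1 else 0 else 0.

(** A left move uses up one unit of [fall_run] and ending a search uses up the extra 1. Advancing
    variable 6 frees 3, more than the one unit that a falling vertex adds; starting a search leaves
    the second summand unchanged. *)
Definition scan_potential (st : state) : nat :=
  3 * (n - vars st 6) +
  if vars st 8 == 0 then fall_run (vars st 6) else (fall_run (vars st 7)).+1.

Lemma fall_run_lt v : rising T v.-1 -> fall_run v = 0.
Proof. by case: v => //= v /rising_fallingF ->. Qed.

Lemma fall_run_gt v : falling T v.-1 -> fall_run v = (fall_run v.-1).+1.
Proof.
case: v => //=; first by rewrite falling0F // Tout.
by move=> v ->.
Qed.

Lemma T00 : T 0 = 0. Proof. exact: Tout. Qed.

Lemma frozen_uptoS v x : frozen_upto v.+1 x =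
  [|| frozen_upto v x, (x == v) && level T v,
      [&& x.+1 == v, falling T x & rising T v]
    | [&& x == v, falling T v.-1 & rising T v]].
Proof.
rewrite /frozen_upto.
have [->|ne] := eqVneq x v; first by lia.
have [<-|ne'] := eqVneq x.+1 v; lia.
Qed.

Lemma frozen_no_start v x : ~~ level T v -> ~~ (falling T v.-1 && rising T v) ->
  frozen_upto v.+1 x = frozen_upto v x.
Proof.
move=> e g; rewrite frozen_uptoS (negPf e) andbF /= (negPf g) andbF orbF.
case: (eqVneq x.+1 v) => [E|_] /=; last by rewrite orbF.
by move: g; rewrite -E /= => /negPf ->; rewrite orbF.
Qed.

Lemma classify_step st : scan_inv st -> vars st 6 < n ->
  (vars st 8 = 1 -> T (vars st 6) < T (vars st 7)) ->
  let st' := run lab (Seq classify (Assign 6 (Succ (Var 6)))) st in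
  scan_inv st' /\ scan_potential st' < scan_potential st.
Proof.
move=> [L /andP[v0 _] act1 iLt iGt iFr iOp iCl iS iV] vn pass /=.
have [V0 V1 Lab] := L.
set v := vars st 6 in v0 vn iLt iGt iFr iOp iCl iS iV pass *.
set a := vars st 7 in iV pass *.
set act := vars st 8 in act1 iOp iCl iS iV pass *.
have label_v : nth 0 lab (arrs st 4 v) = T v by apply: Lab; lia.
have label_Sv : nth 0 lab (arrs st 4 v.+1) = T v.+1 by apply: Lab; lia.
have gtE : (0 < arrs st 6 v.-1) = falling T v.-1.
  by rewrite iGt (_ : v.-1 < v); [case: falling|lia].
(* If a search is running, [T v < T a] and [valley_pass] excludes a collision ending at [v]; so the
   bounds [l < v] and [l <= v] agree here. *)
have op x : 0 < arrs st 8 x <-> exists2 l, innermost n T x l & l <= v.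
  rewrite iOp; split=> -[l I lv]; exists l => //; first by lia.
  have [E0|E1] : act = 0 \/ act = 1 by lia.
    by rewrite E0 addn0.
  have [d V] := iV E1; have [El|] := eqVneq l v; last by lia.
  by case: (valley_pass (n := n) (j := x) V (pass E1)); rewrite -El.
have cl x : 0 < arrs st 9 x <-> exists2 j, innermost n T j x.+1 & x < v.
  rewrite iCl; split=> -[j I lv]; exists j => //; first by lia.
  have [E0|E1] : act = 0 \/ act = 1 by lia.
    by rewrite E0 addn0.
  have [d V] := iV E1; have [El|] := eqVneq x.+1 v; last by lia.
  by case: (valley_pass (n := n) (j := j) V (pass E1)); rewrite -El.
have ltSv x : (x < v.+1) = (x < v) || (x == v) by rewrite ltnS leq_eqVlt orbC.
have old : scan_potential st >= 3 * (n - v) + fall_run v.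
  rewrite /scan_potential -/v -/act -/a; case: ifP => // /eqP act_ne.
  have [|d V] := iV; first by lia.
  rewrite fall_run_lt //; first by lia.
  by case: V => _ _ dv _ lts _ _ _; apply: lts; lia.
rewrite label_v label_Sv /= [upd _ _ _ 6 _]/upd /= gtE.
have ltvE : rising T v = (T v < T v.+1) by rewrite /rising v0.
have eqvE : level T v = (T v == T v.+1) by rewrite /level v0.
case: (ltngtP (T v) (T v.+1)) => [lv|gv|ev].
- rewrite lv in ltvE; have ngv := rising_fallingF ltvE.
  have nev : level T v = false by rewrite eqvE; lia.
  (* The sentinel [T n = 0] keeps the vertex [n.-1] from rising. *)
  have vSn : v.+1 < n.
    rewrite ltnNge; apply/negP => nv.
    by move: lv; rewrite (Tout (i := v.+1)) //; lia.
  have lts x : arrs st 5 x = (x < v) && rising T x := iLt x.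
  have lt_upd x : (if x == v then 1 else arrs st 5 x) = (x < v.+1) && rising T x.
    by rewrite iLt ltSv; case: (eqVneq x v) => [->|]; rewrite ?ltvE ?orbT ?orbF.
  have gt_upd x : arrs st 6 x = (x < v.+1) && falling T x.
    by rewrite iGt ltSv; case: (eqVneq x v) => [->|]; rewrite ?ngv ?andbF ?orbF.
  case: ifP => [g|/negbT ng].
    have V := valley_start T00 g ltvE.
    split; last first.
      move: old; rewrite /scan_potential /= /upd /= -/v /= (fall_run_gt g).
      by lia.
    split; rewrite /= /upd /= -/v ?addn1 //; try by lia.
    + move=> x; rewrite iFr frozen_uptoS nev g ltvE.
      case: (eqVneq x v) => [->|nx]; first by rewrite !orbT.
      case: (eqVneq x v.-1) => [->|nx']; first by rewrite prednK // eqxx g !orbT.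
      by rewrite (_ : x.+1 == v = false) ?orbF //; lia.
    + by move=> x; rewrite op; split=> -[l I lv']; exists l => //; lia.
    + by move=> x; rewrite cl; split=> -[j I lv']; exists j => //; lia.
    + by move=> _; exists v.
  split; last first.
    move: old; rewrite /scan_potential /= /upd /= -/v -/act -/a ngv.
    by case: eqP; lia.
  split; rewrite /= /upd /= -/v -/act -/a //; try by lia.
  + by move=> x; rewrite frozen_no_start ?nev ?(negPf ng).
  + move=> x; rewrite op; split=> -[l I lv']; exists l => //; first by lia.
    have [El|] := eqVneq l v.+1; last by lia.
    have E0 : act = 0 by lia.
    by have [_ /(_ x)[]] := settled_rising (iS E0) ltvE ng; rewrite -El.
  + move=> x; rewrite cl; split=> -[j I lv']; exists j => //; first by lia.
    have [El|] := eqVneq x v; last by lia.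
    have E0 : act = 0 by lia.
    by have [_ /(_ j)[]] := settled_rising (iS E0) ltvE ng; rewrite -El.
  + by move=> /iS S; case: (settled_rising S ltvE ng).
  + move=> E1; have [d V] := iV E1; exists d; apply: valley_move_right => //.
    exact: pass.
- have gtv : falling T v = true by [].
  have ltv : rising T v = false by rewrite ltvE; lia.
  have nev : level T v = false by rewrite eqvE; lia.
  split; last first.
    by move: old; rewrite /scan_potential /= /upd /= -/v gtv; lia.
  split; rewrite /= /upd /= -/v ?addn0 //; try by lia.
  + move=> x; rewrite /= iLt ltSv.
    by case: (eqVneq x v) => [->|]; rewrite ?ltv ?andbF ?orbF.
  + move=> x; rewrite /= ltSv iGt; case: (eqVneq x v) => [->|].
      by rewrite orbT gtv.
    by rewrite orbF.
  + by move=> x; rewrite /= frozen_no_start ?nev ?ltv ?andbF // iFr.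
  + move=> x; rewrite /= op; split=> -[l I lv]; exists l => //; first by lia.
    have [El|] := eqVneq l v.+1; last by lia.
    by case: I => c _; rewrite El in c; case: (falling_no_collision gv c).
  + move=> x; rewrite /= cl; split=> -[j I lv]; exists j => //; first by lia.
    have [El|] := eqVneq x v; last by lia.
    by case: I => c _; rewrite El in c; case: (falling_no_collision gv c).
  + by move=> _; apply: settled_falling.
- have vSn : v.+1 < n.
    rewrite ltnNge; apply/negP => nv.
    move: ev; rewrite (Tout (i := v.+1)); last by lia.
    by have := Tpos (i := v); lia.
  have vE : v.-1.+1 = v by lia.
  have {}eqvE : level T v = true by rewrite eqvE ev eqxx.
  have [ltv gtv] := levelF eqvE.
  have I0 := level_collision eqvE vSn.
  split; last first.
    by move: old; rewrite /scan_potential /= /upd /= -/v gtv; lia.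
  split; rewrite /= /upd /= -/v ?addn0 //; try by lia.
  + move=> x; rewrite /= iLt ltSv.
    by case: (eqVneq x v) => [->|]; rewrite ?ltv ?andbF ?orbF.
  + move=> x; rewrite /= iGt ltSv.
    by case: (eqVneq x v) => [->|]; rewrite ?gtv ?andbF ?orbF.
  + move=> x; rewrite iFr frozen_uptoS eqvE ltv !andbF !orbF andbT.
    by case: (eqVneq x v) => [->|nx]; rewrite ?orbT ?orbF.
  + move=> x; case: (eqVneq x v.-1) => [->|ne1].
      by split=> // _; exists v.+1; rewrite ?addn0.
    rewrite op; split=> [[l I ?]|[l I lv]]; exists l => //; rewrite ?addn0; try by lia.
    have [El|?] := eqVneq l v.+1; last by lia.
    have [[s vs /and4P[]]|[]] := level_innermost eqvE I ltac:(lia); lia.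
  + move=> x; case: (eqVneq x v) => [->|ne1].
      by split=> // _; exists v.-1; rewrite ?addn0.
    rewrite cl; split=> [[j I ?]|[j I lv]]; exists j => //; lia.
  + move=> _ j l I vl.
    by have [//|[_]] := level_innermost eqvE I (ltnW vl); lia.
Qed.

Lemma scan_step st : scan_inv st -> holds lab st scan_test ->
  scan_inv (run lab scan_body st) /\
  scan_potential (run lab scan_body st) < scan_potential st.
Proof.
move=> Inv; have [L /andP[v0 vn] act1 iLt iGt iFr iOp iCl iS iV] := Inv.
move=> /=.
have [V0 V1 Lab] := L; rewrite V0 => {}vn.
set v := vars st 6 in v0 vn iLt iGt iFr iOp iCl iS iV *.
set a := vars st 7 in iV *.
set act := vars st 8 in act1 iOp iCl iS iV *.
have label_v : nth 0 lab (arrs st 4 v) = T v by apply: Lab; lia.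
have label_Sv : nth 0 lab (arrs st 4 v.+1) = T v.+1 by apply: Lab; lia.
have gtE x : x < v -> (0 < arrs st 6 x) = falling T x.
  by move=> xv; rewrite iGt xv; case: falling.
have [E0|E1] : act = 0 \/ act = 1 by lia.
  rewrite E0 ltnn /=; by apply: classify_step => // E; move: E0; rewrite /act E.
have [d V] := iV E1; have [a0 ad dv gs lts hl hr ne] := V.
have label_a : nth 0 lab (arrs st 4 a) = T a by apply: Lab; lia.
have run0 : fall_run v = 0 by apply: fall_run_lt; apply: lts; lia.
rewrite E1 /= label_v label_a -leqNgt.
case: (ltngtP (T a) (T v)) => [av|va|e].
- rewrite gtE; last by lia.
  case: ifP => [g|/negbT g]; rewrite /scan_potential /= /upd /= -/v -/act -/a E1 /=.
    split; last by rewrite [fall_run a]fall_run_gt //; lia.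
    split; rewrite /= /upd /= -/v -/act ?E1 //; try by lia.
    + by move=> x; rewrite iOp E1.
    + by move=> x; rewrite iCl E1.
    + by move=> _; exists d; apply: valley_move_left => //; exact: T00.
  split; last by lia.
  split; rewrite /= /upd /= -/v ?addn0 //; try by lia.
  + move=> x; rewrite iOp E1; split=> [[l I ?]|[l I lv]]; exists l => //; first by lia.
    have [El|?] := eqVneq l v; last by lia.
    have [] := valley_stop V av g I; rewrite ?El //.
    by move=> s vs /and4P[]; lia.
  + move=> x; rewrite iCl E1; split=> [[j I ?]|[j I lv]]; exists j => //; first by lia.
    have [El|?] := eqVneq x.+1 v; last by lia.
    have [] := valley_stop V av g I; rewrite ?El //.
    by move=> s vs /and4P[]; lia.
  + by move=> _ j l I vl; apply: valley_stop V av g I (ltnW vl).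
- by have := classify_step Inv vn (fun _ => va); rewrite /= -/v label_v.
- rewrite /scan_potential /= /upd /= -/v -/act -/a E1 /= run0.
  split; last by lia.
  have av : a.-1.+1 = a by lia.
  have vE : v.-1.+1 = v by lia.
  have I0 := valley_found vn V e.
  split; rewrite /= /upd /= -/v ?addn0 //; try by lia.
  + move=> x; rewrite /=; case: (eqVneq x a.-1) => [->|ne1].
      by split=> // _; exists v; rewrite ?addn0.
    rewrite iOp E1; split=> [[l I ?]|[l I lv]]; exists l => //; first by lia.
    have [El|?] := eqVneq l v; last by lia.
    have [[s vs /and4P[]]|[]] := valley_found_uniq vn V e I ltac:(lia); lia.
  + move=> x; rewrite /=; case: (eqVneq x v.-1) => [->|ne1].
      by split=> // _; exists a.-1; rewrite vE ?addn0.
    rewrite iCl E1; split=> [[j I ?]|[j I lv]]; exists j => //; first by lia.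
    by lia.
  + move=> _ j l I vl.
    by have [//|[_]] := valley_found_uniq vn V e I (ltnW vl); lia.
Qed.

Definition letters_in (st : state) : Prop :=
  forall x, x < n -> letter_at n T x =
    (0 < arrs st 5 x, 0 < arrs st 6 x, 0 < arrs st 7 x, 0 < arrs st 8 x,
     0 < arrs st 9 x).

Lemma scan_runs st : labels_in st ->
  (forall a x, 5 <= a <= 9 -> arrs st a x = 0) -> vars st 8 = 0 ->
  runs_to lab scan st
    (max_cost (Assign 6 c1) + loop_cost scan_test scan_body (3 * n))
    (fun st' => labels_in st' /\ letters_in st').
Proof.
move=> L A0 act0; 
apply: (runs_to_seq (Q1 := fun s => scan_inv s /\ scan_potential s <= 3 * n)).
  apply: runs_to_run => //; split; last first.
    by rewrite /scan_potential /= /upd /= act0 /= falling0F ?T00 //; lia.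
  split; rewrite /= /upd /= ?act0 //; try by lia.
  - by move=> x; rewrite A0 // /rising; case: x.
  - by move=> x; rewrite A0 //; case: x => //; rewrite falling0F ?T00.
  - move=> x; rewrite A0 // /frozen_upto.
    by case: x => [|x] /=; rewrite ?andbF //= falling0F ?T00 //= !andbF.
  - by move=> x; rewrite A0 //; split=> // -[l [[jl _ _ _] _]]; lia.
  - by move=> x; rewrite A0 //; split=> // -[l [[jl _ _ _] _]]; lia.
  - move=> _ j l I _; have [[jl _ _ [s cc]] _] := I.
    by exists s => //; case/and4P: cc; lia.
move=> st1 [I1 p1].
apply: runs_to_le (leq_mul (leqnn _) (p1 : (scan_potential st1).+1 <= (3 * n).+1)) _.
have [T1 [st2 [E B [I2 e]]]] := runs_to_while (lab := lab) (c := scan_body)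
  (potential := scan_potential) isT I1 scan_step.
exists T1, st2; split=> //.
have [L2 /andP[v0 vn] act1 iLt iGt iFr iOp iCl iS iV] := I2.
have {e}vE : vars st2 6 = n.
  by move: e; rewrite /=; case: (L2) => -> _ _; lia.
(* A search still running would make [n.-1] a rising vertex, against the sentinel [T n = 0]. *)
have E0 : vars st2 8 = 0.
  have [//|E1] : vars st2 8 = 0 \/ vars st2 8 = 1 by lia.
  have [d [_ _ dv _ lts _ _ _]] := iV E1.
  have := lts n.-1; rewrite vE /rising prednK // (Tout (i := n)).
    by rewrite ltn0 andbF; lia.
  by rewrite ltnn andbF.
split=> // x xn; rewrite /letter_at iLt iGt iFr vE xn /=.
have -> : frozen T x = frozen_upto n x.
  rewrite /frozen_upto /frozen xn !andTb !andbT; congr (_ || (_ || _)).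
  have [_|e] := ltnP x.+1 n; first by rewrite andbT.
  have -> : rising T x.+1 = false.
    by rewrite /rising (Tout (i := x.+2)) ?ltn0 ?andbF //; lia.
  by rewrite !andbF.
have -> : opens n T x = (0 < arrs st2 8 x).
  apply/asboolP/idP => [[l I]|/iOp[l I _]]; last by exists l.
  by apply/iOp; exists l => //; case: I => [[]]; lia.
have -> : closes n T x = (0 < arrs st2 9 x).
  apply/asboolP/idP => [[l I]|/iCl[l I _]]; last by exists l.
  by apply/iCl; exists l => //; case: I => [[]]; lia.
by case: rising; case: falling; case: frozen_upto.
Qed.

End Scan.

(** * The dynamic program *)

Definition all_states : seq (bool * bool * bool * bool) := enum predT.
Definition code (q : astate) : nat := index q all_states.
Definition cell (a : nat) (q : astate) : expr := Get a (Const (code q)).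

Lemma mem_states q : q \in all_states.
Proof. by rewrite mem_enum. Qed.

Lemma code_eq q q' : (code q == code q') = (q == q').
Proof.
apply/eqP/eqP => [E|->//].
by rewrite -(nth_index q (mem_states q)) -(nth_index q (mem_states q')) -/(code _) E.
Qed.

(* Array 10 maps a state to the least size of a set leading to it, or to [n.+1]
   if there is none; array 11 is its successor under construction. *)
Definition puts (a : nat) (e : astate -> expr) (s : seq astate) : cmd :=
  seqs [seq Put a (Const (code q)) (e q) | q <- s].

Definition move_cost (q : astate) (b : bool) : expr :=
  if b then Succ (cell 10 q) else cell 10 q.

Definition moves (x : letter) : seq (astate * bool * astate) :=
  pmap (fun qb => omap (pair qb) (delta x qb.1 qb.2))
    [seq (q, b) | q <- all_states, b <- [:: true; false]].

Definition relax (m : astate * bool * astate) : cmd :=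
  let: (q, b, q') := m in
  If (Lt (move_cost q b) (cell 11 q'))
    (Put 11 (Const (code q')) (move_cost q b)) Skip.

Definition dp_letter (x : letter) : cmd :=
  Seq (puts 11 (fun=> Succ (Var 0)) all_states)
    (Seq (seqs (map relax (moves x))) (puts 10 (cell 11) all_states)).

Definition by_bit (a : nat) (f : bool -> cmd) : cmd :=
  If (Lt c0 (Get a (Var 9))) (f true) (f false).

(** Branching on five bits gives each of the 32 letters its own straight-line program, so [delta] is
    evaluated when the program is built, not when it runs. *)
Definition by_letter (f : letter -> cmd) : cmd :=
  by_bit 5 (fun l => by_bit 6 (fun g => by_bit 7 (fun r => by_bit 8 (fun s =>
    by_bit 9 (fun e => f (l, g, r, s, e)))))).

Definition dp_body : cmd :=
  Seq (by_letter dp_letter) (Assign 9 (Succ (Var 9))).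
Definition dp_test : test := Lt (Var 9) (Var 0).
Definition dp_init : cmd :=
  Seq (puts 10 (fun=> Succ (Var 0)) all_states)
    (Seq (Put 10 (Const (code start_state)) c0) (Assign 9 c0)).

(** The comparison with [Var 0] rejects the value [n.+1] of an unreached state, which a large bound
    [k] would let through. *)
Definition accept_cmd (q : astate) : cmd :=
  If (And (Not (Lt (Var 0) (cell 10 q))) (Not (Lt (Var 1) (cell 10 q))))
    (Assign 10 c1) Skip.
Definition answer : cmd :=
  Seq (Assign 10 c0)
    (Seq (seqs (map accept_cmd (filter accepting all_states)))
      (Assign 0 (Var 10))).

Lemma mem_moves x q b q' : ((q, b, q') \in moves x) = (delta x q b == Some q').
Proof.
rewrite mem_pmap; apply/mapP/eqP => [[[p c] _]|E].
  by rewrite /=; case D: delta => [p'|] //= [-> -> ->].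
exists (q, b); last by rewrite /= E.
by apply/allpairsP; exists (q, b); rewrite mem_states; case: (b).
Qed.

Lemma run_puts lab a e s st :
  (forall q st i y, eval (set_cell st a i y) (e q) = eval st (e q)) ->
  let st' := run lab (puts a e s) st in
  [/\ vars st' = vars st,
      forall b, b != a -> arrs st' b = arrs st b
    & forall q, arrs st' a (code q) =
        if q \in s then eval st (e q) else arrs st a (code q)].
Proof.
move=> He; elim: s st => [|p s IH] st //=.
have [-> H1 H2] := IH (set_cell st a (code p) (eval st (e p))).
split=> // [b ba|q]; first by rewrite H1 //= /upd (negPf ba).
rewrite H2 He /= /upd eqxx code_eq inE; case: eqP => [->|//] /=.
by case: ifP.
Qed.

Definition cost_of (st : state) (a : nat) (q : astate) : nat := arrs st a (code q).
Arguments cost_of : simpl never.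

Lemma eval_move_cost st q b : eval st (move_cost q b) = cost_of st 10 q + b.
Proof. by case: b => //=; rewrite ?addn1 ?addn0. Qed.

Lemma run_relax lab ms st :
  let st' := run lab (seqs (map relax ms)) st in
  [/\ vars st' = vars st,
      forall b, b != 11 -> arrs st' b = arrs st b,
      forall q', cost_of st' 11 q' <= cost_of st 11 q',
      forall q b q', (q, b, q') \in ms ->
        cost_of st' 11 q' <= cost_of st 10 q + b
    & forall q', cost_of st' 11 q' = cost_of st 11 q' \/
        exists q b, (q, b, q') \in ms /\
          cost_of st' 11 q' = cost_of st 10 q + b].
Proof.
elim: ms st => [|[[p c] p'] ms IH] st /=; first by split=> //; left.
rewrite eval_move_cost -/(cost_of st 11 p').
set st1 := (if _ then _ else _).
have V1 : vars st1 = vars st by rewrite /st1; case: ifP.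
have A1 b : b != 11 -> arrs st1 b = arrs st b.
  by rewrite /st1; case: ifP => //= _ /negPf b11; rewrite /upd b11.
have N1 q : cost_of st1 11 q = if q == p' then
    minn (cost_of st 11 p') (cost_of st 10 p + c) else cost_of st 11 q.
  rewrite /st1; case: ifP => lt.
    rewrite {1}/cost_of /= /upd eqxx /= code_eq.
    by case: ifP => // _; lia.
  by case: eqP => [->|//]; lia.
have C1 q : cost_of st1 10 q = cost_of st 10 q by rewrite /cost_of A1.
have [-> H1 H2 H3 H4] := IH st1; split=> //.
- by move=> b b11; rewrite H1 // A1.
- by move=> q; rewrite (leq_trans (H2 q)) // N1; case: eqP => [->|//]; lia.
- move=> q b q'; rewrite inE => /orP[/eqP[-> -> ->]|/H3]; last by rewrite C1.
  by rewrite (leq_trans (H2 _)) // N1 eqxx; lia.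
- move=> q; case: (H4 q) => [->|[r [b [rm E]]]]; last first.
    by right; exists r, b; rewrite inE rm orbT E C1.
  rewrite N1; case: eqP => [->|_]; last by left.
  have [le|le] := leqP (cost_of st 11 p') (cost_of st 10 p + c); first by left; lia.
  by right; exists p, c; rewrite inE eqxx; split=> //; lia.
Qed.

Lemma run_dp_letter lab x st :
  let st' := run lab (dp_letter x) st in
  [/\ vars st' = vars st,
      forall b, b != 10 -> b != 11 -> arrs st' b = arrs st b,
      forall q b q', delta x q b = Some q' ->
        cost_of st' 10 q' <= cost_of st 10 q + b
    & forall q', cost_of st' 10 q' = (vars st 0).+1 \/
        exists q b, delta x q b = Some q' /\
          cost_of st' 10 q' = cost_of st 10 q + b].
Proof.
rewrite [dp_letter]lock /= -lock /=.
have [V1 A1 N1] := @run_puts lab 11 (fun=> Succ (Var 0)) all_states st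
  (fun _ _ _ _ => erefl).
set st1 := run _ _ st in V1 A1 N1 *.
have [V2 A2 _ R2 E2] := @run_relax lab (moves x) st1.
set st2 := run _ _ st1 in V2 A2 R2 E2 *.
have [V3 A3 N3] := @run_puts lab 10 (cell 11) all_states st2
  (fun _ _ _ _ => erefl).
set st3 := run _ _ st2 in V3 A3 N3 *.
have C3 q : cost_of st3 10 q = cost_of st2 11 q.
  by rewrite /cost_of N3 mem_states.
have C1 q : cost_of st1 10 q = cost_of st 10 q by rewrite /cost_of A1.
split.
- by rewrite V3 V2.
- by move=> b b10 b11; rewrite A3 // A2 // A1.
- move=> q b q' D; rewrite C3 -C1; apply: R2.
  by rewrite mem_moves D.
- move=> q; rewrite C3; case: (E2 q) => [->|[r [b [rm E]]]].
    by left; rewrite /cost_of N1 mem_states.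
  right; exists r, b; rewrite E C1; split=> //.
  by apply/eqP; rewrite -mem_moves.
Qed.

Lemma run_by_letter lab f st : let v := vars st 9 in
  run lab (by_letter f) st =
  run lab (f (0 < arrs st 5 v, 0 < arrs st 6 v, 0 < arrs st 7 v,
              0 < arrs st 8 v, 0 < arrs st 9 v)) st.
Proof. by rewrite /=; do 5 case: ifP => _. Qed.

Lemma loop_free_puts a e s : loop_free (puts a e s).
Proof. by rewrite loop_free_seqs all_map; apply/allP. Qed.

Lemma loop_free_dp_letter x : loop_free (dp_letter x).
Proof.
rewrite /= !loop_free_puts loop_free_seqs all_map andbT.
by apply/allP => -[[q b] q'].
Qed.

Lemma loop_free_by_letter f :
  (forall x, loop_free (f x)) -> loop_free (by_letter f).
Proof. by move=> H; rewrite /= !H. Qed.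

Section DynamicProgram.
Variables (n k : nat) (L : nat -> letter) (lab : seq nat).

(** Attainment is claimed only for costs at most [n], since [n.+1] stands for no set; minimality
    holds without this restriction because [count id bs] never exceeds [n]. *)
Record dp_inv (st : state) : Prop := DpInv {
  dp_n : vars st 0 = n;
  dp_k : vars st 1 = k;
  dp_letters : forall x, x < n -> L x =
    (0 < arrs st 5 x, 0 < arrs st 6 x, 0 < arrs st 7 x, 0 < arrs st 8 x,
     0 < arrs st 9 x);
  dp_v : vars st 9 <= n;
  dp_attained : forall q, cost_of st 10 q <= n -> exists bs,
    [/\ size bs = vars st 9, arun L start_state 0 bs = Some q
      & count id bs = cost_of st 10 q];
  dp_minimal : forall bs q, size bs = vars st 9 ->
    arun L start_state 0 bs = Some q -> cost_of st 10 q <= count id bs }.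

Lemma dp_step st : dp_inv st -> holds lab st dp_test ->
  dp_inv (run lab dp_body st) /\
  n - vars (run lab dp_body st) 9 < n - vars st 9.
Proof.
move=> [v0 v1 vL vn att mini] /=; rewrite v0 => lt.
rewrite -[if _ then _ else _]/(run lab (by_letter dp_letter) st) run_by_letter /=.
rewrite -(vL _ lt).
have := run_dp_letter lab (L (vars st 9)) st.
set st' := run lab _ st; move=> /= [V A M E].
rewrite V; split; last by rewrite /upd /=; lia.
split=> //=; rewrite /upd /= ?V //.
- by move=> x xn; rewrite !A //; exact: vL.
- move=> q; rewrite -[cost_of _ _ _]/(cost_of st' 10 q) => qn.
  case: (E q) => [|[p [b [D Eq]]]]; first by rewrite v0; lia.
  have [bs [sz ar ct]] := att p ltac:(lia).
  exists (rcons bs b); rewrite size_rcons sz arun_rcons ar add0n sz D.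
  by split=> //; rewrite -cats1 count_cat /= addn0 ct -Eq.
- move=> bs q; case/lastP: bs => [|bs b] //; rewrite size_rcons => -[sz].
  rewrite arun_rcons add0n sz; case ar: arun => [p|] // D.
  rewrite -cats1 count_cat /= addn0 (leq_trans (M _ _ _ D)) // leq_add2r.
  exact: mini.
Qed.

Lemma dp_start st : vars st 0 = n -> vars st 1 = k ->
  (forall x, x < n -> L x =
    (0 < arrs st 5 x, 0 < arrs st 6 x, 0 < arrs st 7 x, 0 < arrs st 8 x,
     0 < arrs st 9 x)) ->
  dp_inv (run lab dp_init st) /\ vars (run lab dp_init st) 9 = 0.
Proof.
move=> v0 v1 vL; rewrite [run _ _ _]/=.
have [V A N] := @run_puts lab 10 (fun=> Succ (Var 0)) all_states st
  (fun _ _ _ _ => erefl).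
set st' := run _ _ st in V A N *.
have C q : cost_of (set_var (set_cell st' 10 (code start_state) 0) 9 0) 10 q =
    if q == start_state then 0 else n.+1.
  rewrite /cost_of /= /upd eqxx /= code_eq; case: ifP => // _.
  by rewrite N mem_states /= v0.
split=> //; split=> //=; rewrite /upd /= ?V //.
- by move=> x xn; rewrite !A //; exact: vL.
- by move=> q; rewrite C; case: eqP => [-> _|_]; [exists [::]|lia].
- by move=> [|//] q _ [<-]; rewrite C.
Qed.

Lemma run_accept s st : let st' := run lab (seqs (map accept_cmd s)) st in
  0 < vars st' 10 <-> 0 < vars st 10 \/ exists2 q, q \in s &
     (cost_of st 10 q <= vars st 0) && (cost_of st 10 q <= vars st 1).
Proof.
elim: s st => [|p s IH] st.
  by rewrite /=; split=> [|[//|[q]]]; [left|].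
rewrite /= IH -!leqNgt -/(cost_of st 10 p); case: ifP => cp; rewrite /upd /=.
  split=> _; last by left.
  by right; exists p; rewrite // inE eqxx.
split=> -[h|[q qs h]]; try by left.
  by right; exists q; rewrite // inE qs orbT.
right; exists q => //; move: qs; rewrite inE => /orP[/eqP E|//].
by rewrite -E h in cp.
Qed.

Definition dp : cmd := Seq dp_init (Seq (While dp_test dp_body) answer).
Definition dp_cost : nat :=
  max_cost dp_init + (loop_cost dp_test dp_body n + max_cost answer).

Lemma dp_runs st : vars st 0 = n -> vars st 1 = k ->
  (forall x, x < n -> L x =
    (0 < arrs st 5 x, 0 < arrs st 6 x, 0 < arrs st 7 x, 0 < arrs st 8 x,
     0 < arrs st 9 x)) ->
  runs_to lab dp st dp_cost (fun st' => vars st' 0 != 0 <->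
    exists bs, [/\ size bs = n, exists2 q, arun L start_state 0 bs = Some q &
      accepting q & count id bs <= k]).
Proof.
move=> v0 v1 vL.
apply: (runs_to_seq (Q1 := fun s => dp_inv s /\ vars s 9 = 0)).
  apply: runs_to_run; last exact: dp_start.
  by rewrite /= loop_free_puts.
move=> st1 [I1 E1].
apply: (runs_to_seq (Q1 := fun s => dp_inv s /\ vars s 9 = n)).
  have [||T1 [st2 [E B [I2 e]]]] := runs_to_while (lab := lab) (b := dp_test)
      (c := dp_body) (potential := fun s => n - vars s 9) _ I1.
  - by apply/andP; split=> //; apply: loop_free_by_letter loop_free_dp_letter.
  - exact: dp_step.
  exists T1, st2; split=> //; first by rewrite E1 subn0 in B.
  split=> //; case: (I2) e => v0' _ _ vn _ _ /=; rewrite v0'; lia.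
move=> st2 [[w0 w1 _ _ att mini] wn].
apply: runs_to_run.
  rewrite /= loop_free_seqs all_map andbT; exact/allP.
rewrite /= {1}/upd /= -lt0n run_accept /= /upd /= w0 w1.
split=> [[//|[q]]|[bs [sz [q ar acc] ct]]].
  rewrite mem_filter => /andP[acc _] /andP[/att[bs [sz ar ct]] ck].
  by exists bs; rewrite sz wn ct; split=> //; exists q.
right; exists q; first by rewrite mem_filter acc mem_states.
have h : cost_of st2 10 q <= count id bs by apply: mini => //; rewrite sz.
rewrite -[cost_of _ _ _]/(cost_of st2 10 q) (leq_trans h ct) andbT.
by rewrite (leq_trans h) // -sz count_size.
Qed.

End DynamicProgram.

(** * Recovering the path from the list of time-edges *)

(* Arrays 2 and 3 receive the first and second incident time-edge of each
   vertex, shifted by 1 so that 0 means none. *)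
Definition add_incidence (x : expr) : cmd :=
  If (Lt c0 (Get 2 x)) (Put 3 x (Succ (Var 3))) (Put 2 x (Succ (Var 3))).
Definition incidence_test : test := Lt (Var 3) (Var 2).
Definition incidence_body : cmd :=
  Seq (add_incidence (Get 0 (Var 3)))
    (Seq (add_incidence (Get 1 (Var 3))) (Assign 3 (Succ (Var 3)))).

Definition endpoint_test : test := Lt c0 (Get 3 (Var 4)).
Definition endpoint_body : cmd := Assign 4 (Succ (Var 4)).

Definition walk_start : cmd := Seq (Put 4 c0 (Var 2)) (Assign 3 c1).
Definition walk_test : test := Lt (Var 3) (Var 0).
(* Variable 4 is the current vertex and variable 5 the time-edge that led to it,
   shifted by 1, or 0 at the start. *)
Definition next_edge : cmd :=
  If (eqe (Get 2 (Var 4)) (Var 5)) (Assign 5 (Get 3 (Var 4)))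
    (Assign 5 (Get 2 (Var 4))).
Definition next_vertex : cmd :=
  If (eqe (Get 0 (Pred (Var 5))) (Var 4)) (Assign 4 (Get 1 (Pred (Var 5))))
    (Assign 4 (Get 0 (Pred (Var 5)))).
Definition walk_body : cmd :=
  Seq next_edge (Seq (Put 4 (Var 3) (Pred (Var 5)))
    (Seq next_vertex (Assign 3 (Succ (Var 3))))).
(* The position [m] is out of range, hence stands for the sentinel label 0. *)
Definition walk_end : cmd := Put 4 (Var 0) (Var 2).

Definition walk_cmd : cmd :=
  Seq walk_start (Seq (While walk_test walk_body) walk_end).

Definition algorithm : cmd :=
  Seq (While incidence_test incidence_body)
    (Seq (While endpoint_test endpoint_body) (Seq walk_cmd (Seq scan dp))).

Section Incidence.
Variables (m : nat) (U V : nat -> nat).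
Hypothesis UV : forall i, i < m -> U i <> V i.

Definition incident (x i : nat) : bool := (U i == x) || (V i == x).
Definition incidences (j x : nat) : seq nat :=
  [seq i.+1 | i <- iota 0 j & incident x i].

Hypothesis degree2 : forall x, size (incidences m x) <= 2.

Lemma incidencesS j x : incidences j.+1 x =
  if incident x j then rcons (incidences j x) j.+1 else incidences j x.
Proof.
rewrite /incidences -{1}addn1 iotaD filter_cat map_cat /= add0n.
by case: (incident x j) => /=; rewrite ?cats0 ?cats1.
Qed.

Lemma mem_incidences j x y :
  (y \in incidences j x) = [&& 0 < y, y <= j & incident x y.-1].
Proof.
apply/mapP/and3P => [[i]|[y0 yj h]].
  by rewrite mem_filter mem_iota => /and3P[h _ ij] ->.
exists y.-1; last by rewrite prednK.
by rewrite mem_filter mem_iota h /=; lia.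
Qed.

Lemma uniq_incidences j x : uniq (incidences j x).
Proof.
by rewrite map_inj_uniq; [apply: filter_uniq; exact: iota_uniq|move=> ? ? []].
Qed.

Lemma size_incidences_le j x : j <= m -> size (incidences j x) <= 2.
Proof.
move=> jm; apply: leq_trans (degree2 x); apply: uniq_leq_size.
  exact: uniq_incidences.
by move=> y; rewrite !mem_incidences => /and3P[-> yj ->]; lia.
Qed.

Lemma size_incidence_lt j x : j < m -> incident x j -> size (incidences j x) < 2.
Proof.
move=> jm h; have := size_incidences_le x jm.
by rewrite incidencesS h size_rcons.
Qed.

Record incidence_inv (st0 st : state) : Prop := IncidenceInv {
  inc_vars : forall y, y != 3 -> vars st y = vars st0 y;
  inc_arrs : forall a, a != 2 -> a != 3 -> arrs st a = arrs st0 a;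
  inc_j : vars st 3 <= m;
  inc_fst : forall x, arrs st 2 x = nth 0 (incidences (vars st 3) x) 0;
  inc_snd : forall x, arrs st 3 x = nth 0 (incidences (vars st 3) x) 1 }.

Variables (lab : seq nat) (st0 : state).
Hypothesis st0U : arrs st0 0 = U.
Hypothesis st0V : arrs st0 1 = V.
Hypothesis st0m : vars st0 2 = m.

Lemma incidence_step st : incidence_inv st0 st -> holds lab st incidence_test ->
  incidence_inv st0 (run lab incidence_body st) /\
  m - vars (run lab incidence_body st) 3 < m - vars st 3.
Proof.
move=> [iv ia ij i1 i2]; rewrite [holds _ _ _]/= (iv 2) // st0m => jm.
have head_pos j x : (0 < nth 0 (incidences j x) 0) = (0 < size (incidences j x)).
  have : all (fun y => 0 < y) (incidences j x).
    by apply/allP => y; rewrite mem_incidences => /andP[].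
  by case: incidences => [|y s] //= /andP[->].
have add_one st1 e x : eval st1 e = x -> vars st1 3 = vars st 3 ->
    let st2 := run lab (add_incidence e) st1 in
    [/\ vars st2 = vars st1,
        forall a, a != 2 -> a != 3 -> arrs st2 a = arrs st1 a
      & size (incidences (vars st 3) x) < 2 ->
        (forall s, s = incidences (vars st 3) x ->
        arrs st1 2 x = nth 0 s 0 -> arrs st1 3 x = nth 0 s 1 ->
        forall y, arrs st2 2 y =
            (if y == x then nth 0 (rcons s (vars st 3).+1) 0 else arrs st1 2 y) /\
          arrs st2 3 y =
            (if y == x then nth 0 (rcons s (vars st 3).+1) 1 else arrs st1 3 y))].
  move=> ex e3 /=; rewrite ex e3.
  split; [by case: ifP| |].
    by move=> a a2 a3; case: ifP => _ /=; rewrite /upd ?(negPf a2) ?(negPf a3).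
  move=> lt2 s Es E2 E3 y; rewrite E2 Es head_pos -Es.
  rewrite -Es in lt2.
  case: s lt2 {Es} E2 E3 => [|z [|//]] _ /= E2 E3; rewrite /upd /=;
    by case: (eqVneq y x) => [->|].
set v := vars st 3 in ij i1 i2 jm add_one *.
have uv := UV jm.
have [V1 A1 R1] := add_one st (Get 0 (Var 3)) (U v)
  ltac:(by rewrite /= ia // st0U) erefl.
set st1 := run lab (add_incidence _) st in V1 A1 R1 *.
have [V2 A2 R2] := add_one st1 (Get 1 (Var 3)) (V v)
  ltac:(by rewrite /= A1 // ia // st0V V1) ltac:(by rewrite V1).
set st2 := run lab (add_incidence _) st1 in V2 A2 R2 *.
have incU : incident (U v) v by rewrite /incident eqxx.
have incV : incident (V v) v by rewrite /incident eqxx orbT.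
have {}R1 := R1 (size_incidence_lt jm incU) _ erefl (i1 _) (i2 _).
have nVU : (V v == U v) = false by apply/eqP => E; apply: uv.
have {}R2 := R2 (size_incidence_lt jm incV) _ erefl
  ltac:(by have [-> _] := R1 (V v); rewrite nVU i1)
  ltac:(by have [_ ->] := R1 (V v); rewrite nVU i2).
have v3 : vars st2 3 = v by rewrite V2 V1.
have R y : arrs st2 2 y = nth 0 (incidences v.+1 y) 0 /\
           arrs st2 3 y = nth 0 (incidences v.+1 y) 1.
  have [-> ->] := R2 y; have [-> ->] := R1 y.
  rewrite incidencesS /incident [U v == y]eq_sym [V v == y]eq_sym i1 i2.
  case: (eqVneq y (V v)) => [->|_]; first by rewrite orbT.
  by case: (eqVneq y (U v)) => [->|_].
have -> : run lab incidence_body st = set_var st2 3 (vars st2 3).+1 by [].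
split; last by rewrite /= /upd /= v3; lia.
split; rewrite /= /upd /= ?v3.
- by move=> y /negPf y3; rewrite y3 V2 V1 iv ?y3.
- by move=> a a2 a3; rewrite A2 // A1 // ia.
- exact: jm.
- by move=> x; case: (R x).
- by move=> x; case: (R x).
Qed.

Lemma incidence_runs : vars st0 3 = 0 ->
  (forall x, arrs st0 2 x = 0) -> (forall x, arrs st0 3 x = 0) ->
  runs_to lab (While incidence_test incidence_body) st0
    (loop_cost incidence_test incidence_body m)
    (fun st => incidence_inv st0 st /\ vars st 3 = m).
Proof.
move=> v3 a2 a3.
have I0 : incidence_inv st0 st0.
  by split=> //; rewrite v3 // => x; rewrite ?a2 ?a3.
have [||T [st [E B [I e]]]] := runs_to_while (lab := lab)
    (b := incidence_test) (c := incidence_body)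
    (potential := fun st => m - vars st 3) _ I0.
- by [].
- exact: incidence_step.
exists T, st; split=> //; first by rewrite v3 subn0 in B.
split=> //; move: e; case: I => iv _ jm _ _; rewrite /= (iv 2) // st0m; lia.
Qed.

End Incidence.

(* Position [i] of the path holds the vertex [pos i], and its [i]-th edge is
   the entry [key i] of the list of time-edges. *)
Record keyed_path (n m : nat) (U V pos key : nat -> nat) : Prop := KeyedPath {
  path_n0 : 0 < n;
  path_inj : forall i j, i < n -> j < n -> pos i = pos j -> i = j;
  path_surj : forall x, x < n -> exists2 i, i < n & pos i = x;
  path_lt : forall i, pos i < n;
  key_lt : forall i, 0 < i < n -> key i < m;
  key_inj : forall i j, 0 < i < n -> 0 < j < n -> key i = key j -> i = j;
  key_surj : forall x, x < m -> exists2 i, 0 < i < n & key i = x;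
  key_ends : forall i, 0 < i < n ->
    (U (key i) = pos i.-1 /\ V (key i) = pos i) \/
    (U (key i) = pos i /\ V (key i) = pos i.-1);
  ends_lt : forall i, i < m -> (U i < n) && (V i < n) }.

Section Traversal.
Variables (n m : nat) (U V pos key : nat -> nat).
Hypothesis K : keyed_path n m U V pos key.
Let n0 := path_n0 K.
Let pos_inj := path_inj K.
Let pos_surj := path_surj K.
Let pos_lt := path_lt K.
Let key_lt := key_lt K.
Let key_inj := key_inj K.
Let key_surj := key_surj K.
Let ends := key_ends K.
Let ends_lt := ends_lt K.

Notation incidences := (incidences U V m).

Lemma incident_key v i : v < n -> 0 < i < n ->
  incident U V (pos v) (key i) = (v == i.-1) || (v == i).
Proof.
move=> vn i0.
have E x : x < n -> (pos x == pos v) = (v == x).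
  by move=> xn; apply/eqP/eqP => [/pos_inj ->|->].
rewrite /incident; case: (ends i0) => -[-> ->]; rewrite !E //; try by lia.
Qed.

Lemma mem_incidences_pos v y : v < n -> y \in incidences (pos v) <->
  (0 < v /\ y = (key v).+1) \/ (v.+1 < n /\ y = (key v.+1).+1).
Proof.
move=> vn; rewrite mem_incidences; split=> [/and3P[y0 ym]|].
  have [i i0 E] := key_surj (x := y.-1) ltac:(lia).
  rewrite -E incident_key // => /orP[/eqP Ev|/eqP Ev].
    by right; rewrite Ev prednK; [split|]; lia.
  by left; rewrite Ev; split; lia.
case=> -[h ->] /=; rewrite key_lt ?incident_key //; try by lia.
Qed.

Lemma ends_neq i : i < m -> U i <> V i.
Proof.
move=> /key_surj[j j0 <-] E.
have : pos j.-1 = pos j by case: (ends j0) => -[]; congruence.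
by move/pos_inj; lia.
Qed.

Lemma degree_le2 x : size (incidences x) <= 2.
Proof.
have [xn|nx] := ltnP x n; last first.
  case E: incidences => [|y s] //.
  have : y \in incidences x by rewrite E mem_head.
  rewrite mem_incidences /incident => /and3P[y0 ym].
  by have := @ends_lt y.-1; lia.
have [v vn <-] := pos_surj xn.
apply: (uniq_leq_size (s2 := [:: (key v).+1; (key v.+1).+1])).
  exact: uniq_incidences.
move=> y /(mem_incidences_pos _ vn); rewrite !inE.
by case=> -[_ ->]; rewrite eqxx ?orbT.
Qed.

Lemma incidences_inner v : 0 < v -> v.+1 < n ->
  incidences (pos v) = [:: (key v).+1; (key v.+1).+1] \/
  incidences (pos v) = [:: (key v.+1).+1; (key v).+1].
Proof.
move=> v0 vn; have M y := @mem_incidences_pos v y ltac:(lia).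
have := uniq_incidences U V m (pos v); have := degree_le2 (pos v).
have h1 : (key v).+1 \in incidences (pos v) by apply/M; left.
have h2 : (key v.+1).+1 \in incidences (pos v) by apply/M; right.
have ne : key v <> key v.+1 by move/key_inj; lia.
case: (incidences (pos v)) h1 h2 => [|x [|y [|? ?]]] //; rewrite !inE.
  by move=> /eqP h1 /eqP h2; case: ne; lia.
move=> /orP[/eqP h1|/eqP h1] /orP[/eqP h2|/eqP h2] _ _; try lia.
  by left; rewrite h1 h2.
by right; rewrite h1 h2.
Qed.

Lemma incidences_first : 1 < n -> incidences (pos 0) = [:: (key 1).+1].
Proof.
move=> n1; have M y := @mem_incidences_pos 0 y n0.
have h1 : (key 1).+1 \in incidences (pos 0) by apply/M; right.
have := uniq_incidences U V m (pos 0).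
have sub y : y \in incidences (pos 0) -> y = (key 1).+1.
  by move=> /M[[]|[]].
case: (incidences (pos 0)) h1 sub => [|x [|y s]] // _ sub.
  by rewrite (sub x) ?mem_head.
have -> : x = y by rewrite (sub x) ?mem_head // (sub y) // !inE eqxx orbT.
by rewrite /= mem_head.
Qed.

Lemma snd_incidence_first : nth 0 (incidences (pos 0)) 1 = 0.
Proof.
have [n1|n1] := ltnP 1 n; first by rewrite incidences_first.
case E: incidences => [|y s] //.
have : y \in incidences (pos 0) by rewrite E mem_head.
by move/(mem_incidences_pos _ n0) => [[]|[]]; lia.
Qed.

Lemma endpoint_ends v : v < n -> nth 0 (incidences (pos v)) 1 = 0 ->
  v = 0 \/ v = n.-1.
Proof.
move=> vn; have [->|v0] := posnP v; first by left.
have [vn'|] := ltnP v.+1 n; last by right; lia.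
by case: (incidences_inner v0 vn') => ->.
Qed.

Variable lab : seq nat.

(** The number [pos 0] bounds the search, as that vertex has no second incident edge; the vertex
    found may still be the other end of the path. *)
Lemma endpoint_runs st0 :
  (forall x, arrs st0 3 x = nth 0 (incidences x) 1) -> vars st0 4 = 0 ->
  runs_to lab (While endpoint_test endpoint_body) st0
    (loop_cost endpoint_test endpoint_body n)
    (fun st => [/\ forall y, y != 4 -> vars st y = vars st0 y,
       arrs st = arrs st0, vars st 4 < n
       & nth 0 (incidences (vars st 4)) 1 = 0]).
Proof.
move=> Y c0.
pose I st := [/\ forall y, y != 4 -> vars st y = vars st0 y,
   arrs st = arrs st0 & vars st 4 <= pos 0].
have I0 : I st0 by split; rewrite ?c0.
have [||T [st [E B [[iv ia ic] e]]]] := runs_to_while (lab := lab)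
    (b := endpoint_test) (c := endpoint_body)
    (potential := fun st => n - vars st 4) _ I0.
- by [].
- move=> st [iv ia ic]; rewrite /= ia Y => h.
  have lt : vars st 4 < pos 0.
    rewrite ltn_neqAle ic andbT; apply/eqP => E.
    by rewrite E snd_incidence_first in h.
  split; last by rewrite /upd /=; have := pos_lt 0; lia.
  by split=> // y y4; rewrite /= /upd (negPf y4) iv.
exists T, st; split=> //; first by rewrite c0 subn0 in B.
split=> //; first by have := pos_lt 0; lia.
by move: e; rewrite /= ia Y -leqNgt leqn0 => /eqP.
Qed.

Record walk_inv (st0 st : state) : Prop := WalkInv {
  walk_vars : forall y, y \notin [:: 3; 4; 5] -> vars st y = vars st0 y;
  walk_arrs : forall a, a != 4 -> arrs st a = arrs st0 a;
  walk_i : 0 < vars st 3 <= n;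
  walk_cur : vars st 4 = pos (vars st 3).-1;
  walk_last : vars st 5 =
    if vars st 3 == 1 then 0 else (key (vars st 3).-1).+1;
  walk_0 : arrs st 4 0 = m;
  walk_key : forall j, 0 < j < vars st 3 -> arrs st 4 j = key j }.

Variable st0 : state.
Hypothesis st0n : vars st0 0 = n.
Hypothesis st0m : vars st0 2 = m.
Hypothesis st0U : arrs st0 0 = U.
Hypothesis st0V : arrs st0 1 = V.
Hypothesis st0X : forall x, arrs st0 2 x = nth 0 (incidences x) 0.
Hypothesis st0Y : forall x, arrs st0 3 x = nth 0 (incidences x) 1.

Lemma walk_step st : walk_inv st0 st -> holds lab st walk_test ->
  walk_inv st0 (run lab walk_body st) /\
  n - vars (run lab walk_body st) 3 < n - vars st 3.
Proof.
move=> [iv ia ii ic il i0 ik]; rewrite [holds _ _ _]/= (iv 0) // st0n => lt.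
set i := vars st 3 in ii ic il ik lt *.
pose st1 := set_var st 5 (key i).+1.
have E1 : run lab next_edge st = st1.
  rewrite [run _ _ _]/= -[_ && _]/(holds lab st (eqe (Get 2 (Var 4)) (Var 5))).
  rewrite holds_eqe /= !ia // ic st0X st0Y il.
  (* At the start variable 5 is 0, which no shifted time-edge equals, so the first incidence is
     taken; later it is the incidence other than the one just used. *)
  have [e1|ne1] := eqVneq i 1.
    by rewrite /st1 e1 incidences_first //; lia.
  have iE : i.-1.+1 = i by lia.
  have ne : key i <> key i.-1 by move/key_inj; lia.
  have [|] := incidences_inner (v := i.-1) ltac:(lia) ltac:(lia); rewrite iE => -> /=.
    by rewrite eqxx.
  by rewrite eqSS; case: eqP.
pose st2 := set_cell st1 4 i (key i).
have E2 : run lab next_vertex st2 = set_var st2 4 (pos i).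
  rewrite [run _ _ _]/= -[_ && _]/(holds lab st2 (eqe (Get 0 (Pred (Var 5))) (Var 4))).
  rewrite holds_eqe /= /upd /= !ia // ic st0U st0V.
  have ne : pos i <> pos i.-1 by move/pos_inj; lia.
  have [[-> ->]|[-> ->]] := ends (i := i) ltac:(lia); first by rewrite eqxx.
  by case: eqP.
have E3 : run lab walk_body st = set_var (set_var st2 4 (pos i)) 3 i.+1.
  rewrite -E2 /walk_body.
  transitivity (run lab (Assign 3 (Succ (Var 3))) (run lab next_vertex
    (run lab (Put 4 (Var 3) (Pred (Var 5))) (run lab next_edge st)))) => //.
  by rewrite E1 [run _ (Put _ _ _) _]/= -/st2 E2.
rewrite E3; split; last by rewrite /= /upd /=; lia.
split; rewrite /= /upd /= -/i.
- move=> y; rewrite !inE !negb_or => /and3P[/negPf y3 /negPf y4 /negPf y5].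
  by rewrite y3 y4 y5 iv // !inE y3 y4 y5.
- by move=> a /negPf a4; rewrite a4 ia ?a4.
- lia.
- by [].
- by case: eqP => // ?; lia.
- by case: eqP => // ?; lia.
- by move=> j /andP[j0 ji]; case: (eqVneq j i) => [->//|ne]; apply: ik; lia.
Qed.

Lemma walk_runs : vars st0 5 = 0 -> vars st0 4 = pos 0 ->
  runs_to lab walk_cmd st0
    (max_cost walk_start + (loop_cost walk_test walk_body n + max_cost walk_end))
    (fun st => [/\ forall y, y \notin [:: 3; 4; 5] -> vars st y = vars st0 y,
       forall a, a != 4 -> arrs st a = arrs st0 a,
       forall j, 0 < j < n -> arrs st 4 j = key j
       & arrs st 4 0 = m /\ arrs st 4 n = m]).
Proof.
move=> v5 v4.
apply: (runs_to_seq (Q1 := fun s => walk_inv st0 s /\ vars s 3 = 1)).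
  apply: runs_to_run => //; split=> //; split; rewrite /= /upd /= ?v4 ?v5 //.
  - by move=> y; rewrite !inE !negb_or => /and3P[/negPf -> _ _].
  - by move=> a /negPf a4; rewrite a4.
  - by move=> j; lia.
move=> st1 [I1 i1].
apply: (runs_to_seq (Q1 := fun s => walk_inv st0 s /\ vars s 3 = n)).
  have [||T [st [E B [I e]]]] := runs_to_while (lab := lab)
      (b := walk_test) (c := walk_body)
      (potential := fun st => n - vars st 3) _ I1.
  - by [].
  - exact: walk_step.
  exists T, st; split=> //.
    by apply: leq_trans B _; apply: leq_mul => //; lia.
  by split=> //; move: e; case: I => iv _ ii _ _ _ _; rewrite /= (iv 0) // st0n; lia.
move=> st2 [[iv ia ii ic il i0 ik] e].
apply: runs_to_run => //; split; rewrite /= /upd /= ?iv ?st0n ?st0m //.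
- by move=> a /negPf a4; rewrite a4 ia ?a4.
- by move=> j jn; case: eqP => [E|_]; [lia|apply: ik; rewrite e].
- by rewrite eqxx; case: eqP.
Qed.

End Traversal.

(** * The algorithm *)

Section Instance.
Variables (n k : nat) (G : tgraph 'I_n) (w : seq ('I_n * 'I_n * nat)).
Hypothesis enc : encodes w G.
Hypothesis n0 : 0 < n.

Definition first_end : nat -> nat := nth 0 [seq nat_of_ord x.1.1 | x <- w].
Definition second_end : nat -> nat := nth 0 [seq nat_of_ord x.1.2 | x <- w].

Section Keys.
Variables (pos : nat -> 'I_n) (T : nat -> nat).
Hypothesis L : line_of G pos T.

Definition key (i : nat) : nat :=
  index (edge pos i, T i) (map (@time_edge n) w).

Lemma mem_time_edges e t : (e, t) \in map (@time_edge n) w <->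
  exists2 i, 0 < i < n & (e, t) = (edge pos i, T i).
Proof.
case: enc => _ ->; split=> [/andP[/(edgesE L)[i i0 ->]]|[i i0 [-> ->]]].
  by rewrite (labelsE L) // => /eqP ->; exists i.
by rewrite (labelsE L) // eqxx andbT; apply/(edgesE L); exists i.
Qed.

(** One label per edge means one entry per edge, so the length of the input is bounded in terms of
    [n] alone. *)
Lemma size_time_edges : size w = n.-1.
Proof.
rewrite -(size_map (@time_edge n)).
have -> : n.-1 = size [seq (edge pos i, T i) | i <- iota 1 n.-1].
  by rewrite size_map size_iota.
apply/perm_size/uniq_perm; first by case: enc.
  rewrite map_inj_in_uniq ?iota_uniq // => i j; rewrite !mem_iota => hi hj [E _].
  by apply: (edge_inj L) E; lia.
move=> [e t]; apply/idP/mapP => [/mem_time_edges[i i0 ->]|[i]].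
  by exists i; rewrite // mem_iota; lia.
rewrite mem_iota => hi E; apply/mem_time_edges; exists i => //; lia.
Qed.

Lemma key_mem i : 0 < i < n ->
  (edge pos i, T i) \in map (@time_edge n) w.
Proof. by move=> i0; apply/mem_time_edges; exists i. Qed.

Lemma nth_key i x0 : 0 < i < n ->
  time_edge (nth x0 w (key i)) = (edge pos i, T i).
Proof.
move=> i0; have h := key_mem i0.
rewrite -(nth_index (time_edge x0) h) (nth_map x0) //.
by rewrite -(size_map (@time_edge n)) index_mem.
Qed.

Lemma key_size i : 0 < i < n -> key i < n.-1.
Proof.
by move=> i0; rewrite -size_time_edges -(size_map (@time_edge n)) index_mem key_mem.
Qed.

Lemma key_label i : 0 < i < n -> nth 0 (unzip2 w) (key i) = T i.
Proof.
move=> i0; pose x0 := (pos 0, pos 0, 0).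
have := nth_key x0 i0; rewrite (nth_map x0); last first.
  by rewrite size_time_edges; exact: key_size.
by case.
Qed.

Lemma key_path :
  keyed_path n n.-1 first_end second_end (fun i => pos i) key.
Proof.
pose x0 := (pos 0, pos 0, 0).
have Fst i : i < n.-1 -> first_end i = (nth x0 w i).1.1.
  by move=> h; rewrite /first_end (nth_map x0) // size_time_edges.
have Snd i : i < n.-1 -> second_end i = (nth x0 w i).1.2.
  by move=> h; rewrite /second_end (nth_map x0) // size_time_edges.
split=> //.
- by move=> i j ni nj /val_inj /(pos_inj L) ->.
- move=> x xn; have [i ni E] := pos_surj L (Ordinal xn).
  by exists i; rewrite // E.
- exact: key_size.
- move=> i j i0 j0 E; have := nth_key x0 i0; rewrite E (nth_key x0 j0) => -[e _].
  by apply: esym; apply: (edge_inj L) e.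
- move=> x xm; have xw : x < size w by rewrite size_time_edges.
  have := mem_nth (time_edge x0) (s := map (@time_edge n) w) (n := x).
  rewrite size_map (nth_map x0) // => /(_ xw).
  case E: (time_edge _) => [e t] /mem_time_edges[i i0 Ei]; exists i => //.
  rewrite /key -Ei -E -(nth_map x0 (time_edge x0)) // index_uniq ?size_map //.
  by case: enc.
- move=> i i0; have ki := key_size i0.
  rewrite Fst // Snd //; have [E _] := nth_key x0 i0.
  set a := (nth x0 w (key i)).1.1 in E *; set b := (nth x0 w (key i)).1.2 in E *.
  have c2 : #|[set a; b]| = 2.
    by rewrite E; apply: (@edges_card2 _ G); apply/(edgesE L); exists i.
  have ab : a != b by apply/eqP => ab; move: c2; rewrite ab setUid cards1.
  have ha : a \in edge pos i by rewrite -E !inE eqxx.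
  have hb : b \in edge pos i by rewrite -E !inE eqxx orbT.
  move: ha hb ab; rewrite !inE.
  by move=> /orP[]/eqP-> /orP[]/eqP->; rewrite ?eqxx // => _; [left|right].
- by move=> i im; rewrite Fst // Snd // !ltn_ord.
Qed.

End Keys.

Variables (pos : nat -> 'I_n) (T : nat -> nat).
Hypothesis L : line_of G pos T.

(* The endpoint found may be either end; in one case the line is reversed. *)
Lemma line_from v : v = 0 \/ v = n.-1 ->
  exists pos' T', line_of G pos' T' /\ pos' 0 = pos v.
Proof.
case=> ->; first by exists pos, T.
exists (fun i => pos (n.-1 - i)), (fun i => T (n - i)).
by split; [exact: line_rev|rewrite subn0].
Qed.

Definition total_cost : nat :=
  loop_cost incidence_test incidence_body n.-1 +
  (loop_cost endpoint_test endpoint_body n +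
  ((max_cost walk_start + (loop_cost walk_test walk_body n + max_cost walk_end)) +
  ((max_cost (Assign 6 c1) + loop_cost scan_test scan_body (3 * n)) +
  dp_cost n))).

Lemma algorithm_runs :
  runs_to (unzip2 w) algorithm (init_state k w) total_cost
    (fun st => vars st 0 != 0 <-> has_temporal_resolving_set G k).
Proof.
have K := key_path L; have sw := size_time_edges L.
apply: runs_to_seq.
  apply: (incidence_runs (m := n.-1) (U := first_end) (V := second_end)) => //=.
  - by move=> i; exact: (ends_neq K).
  - exact: (degree_le2 K).
move=> st1 [[V1 A1 _ X1 Y1] j1]; rewrite j1 in X1 Y1.
apply: runs_to_seq; first by apply: (endpoint_runs K) => //; rewrite V1.
move=> st2 [V2 A2 cn c0].
have [v vn cv] := path_surj K cn.
have [|pos' [T' [L' p0]]] := @line_from v.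
  by apply: (endpoint_ends K vn); rewrite cv.
have K' := key_path L'.
apply: runs_to_seq.
  apply: (walk_runs K'); rewrite ?A2 //.
  - by rewrite V2 // V1.
  - by rewrite V2 // V1 //= sw.
  - by rewrite A1.
  - by rewrite A1.
  - by rewrite V2 // V1.
  - by rewrite p0 -cv.
move=> st3 [V3 A3 P3 [P0 Pn]].
have v3 y : y \notin [:: 3; 4; 5] -> vars st3 y = vars (init_state k w) y.
  move=> h; rewrite V3 // V2 ?V1 //; apply: contraNneq h => ->; by [].
have a3 a : 4 < a -> arrs st3 a = arrs (init_state k w) a.
  by move=> h; rewrite A3 ?A2 ?A1 //; case: a h => [|[|[|[|[|]]]]].
have Tout i : ~~ (0 < i < n) -> T' i = 0 by exact: label_out L' i.
have Tpos i : 0 < i < n -> 0 < T' i by exact: label_pos L' i.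
(* The position [n.-1] is the length of the label sequence, so reading it yields the default 0, the
   sentinel label. *)
have nth_m : nth 0 (unzip2 w) n.-1 = 0.
  by rewrite nth_default // size_map sw.
apply: runs_to_seq.
  apply: (scan_runs (n := n) (k := k) (T := T')) => //.
  - split; rewrite ?v3 // => i il.
    have [->|i0] := posnP i; first by rewrite P0 nth_m Tout.
    have [->|ne] := eqVneq i n; first by rewrite Pn nth_m Tout // ltnn andbF.
    have i1 : 0 < i < n by lia.
    by rewrite P3 // key_label.
  - by move=> [|[|a]] x h //; rewrite a3 /= ?nth_nil //; lia.
  - by rewrite v3.
move=> st4 [[W0 W1 _] Let].
have [T1 [st5 [E B Q]]] := dp_runs (unzip2 w) W0 W1 Let.
exists T1, st5; split=> //.
rewrite Q (resolving_line _ L').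
split=> -[bs [sz h ct]]; exists bs; split=> //.
  by apply/(automaton_correct Tpos sz).
by apply/(automaton_correct Tpos sz).
Qed.

End Instance.

Lemma loop_cost_le b c f a n : 0 < n -> f <= a * n ->
  loop_cost b c f <= (test_cost b + max_cost c).+1 * a.+1 * n.
Proof.
move=> n0 fa; rewrite /loop_cost -mulnA leq_mul2l; apply/orP; right.
by rewrite mulSn; lia.
Qed.

Lemma total_cost_linear : exists C, forall n, 0 < n -> total_cost n <= C * n.
Proof.
have add f g : (exists C, forall n, 0 < n -> f n <= C * n) ->
    (exists C, forall n, 0 < n -> g n <= C * n) ->
    exists C, forall n, 0 < n -> f n + g n <= C * n.
  move=> [C1 H1] [C2 H2]; exists (C1 + C2) => n n0.
  by rewrite mulnDl leq_add ?H1 ?H2.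
have const x : exists C, forall n, 0 < n -> x <= C * n.
  by exists x => n n0; rewrite leq_pmulr.
have loop b c f a : (forall n, f n <= a * n) ->
    exists C, forall n, 0 < n -> loop_cost b c (f n) <= C * n.
  by move=> H; eexists => n n0; apply: loop_cost_le n0 (H n).
rewrite /total_cost /dp_cost.
apply: (add (fun n => loop_cost _ _ n.-1)).
  by apply: (loop _ _ _ 1) => n; lia.
apply: (add (fun n => loop_cost _ _ n)).
  by apply: (loop _ _ id 1) => n; lia.
apply: (add (fun n => _ + (loop_cost _ _ n + _))).
  apply: (add (fun=> _)) => //; apply: (add (fun n => loop_cost _ _ n)) => //.
  by apply: (loop _ _ id 1) => n; lia.
apply: (add (fun n => _ + loop_cost _ _ (3 * n))).
  apply: (add (fun=> _)) => //.
  by apply: (loop _ _ (muln 3) 3) => n; lia.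
apply: (add (fun=> _)) => //; apply: (add (fun n => loop_cost _ _ n)) => //.
by apply: (loop _ _ id 1) => n; lia.
Qed.

Theorem theorem6 :
  exists (algo : cmd) (C : nat),
    forall (n k : nat) (G : tgraph 'I_n) (w : seq ('I_n * 'I_n * nat)),
      temporal_path G -> one_labeling G -> encodes w G ->
      decides_within algo k w (C * n) (has_temporal_resolving_set G k).
Proof.
have [C HC] := total_cost_linear.
exists algorithm, C => n k G w tp one enc.
have n0 : 0 < n by case: tp => -[x xn] _; exact: leq_ltn_trans xn.
have [pos [T L]] := line_ex tp one.
exact: runs_to_le (HC n n0) (algorithm_runs k enc n0 L).
Qed.
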